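(* Let $R$ be an integral domain, $\ast$ a star operation of finite type on $R$ and $X$ an indeterminate over $R$. Then $R$ is a $\ast$-almost Dedekind $\ast$-SP-domain (i.e. both $\ast$-almost Dedekind and a $\ast$-SP-domain) if and only if the $\ast$-Nagata ring ${\rm Na}(R,\ast)$ is an SP-domain.
   Context: $R$ is regarded as a multiplicative monoid with zero; $K$ denotes its field of quotients. A star operation of finite type on $R$ is a map $\ast:\mathbb{P}(R)\to\mathbb{P}(R)$, $Y\mapsto Y_\ast$ ($\mathbb{P}$ = power set) such that for all $Y,Z\subseteq R$, $c\in R$: $Y_\ast$ contains ${}_R(Y)$, the ring ideal generated by $Y$; $Y\subseteq Z_\ast$ implies $Y_\ast\subseteq Z_\ast$; $cY_\ast=(cY)_\ast$; and $Y_\ast=\bigcup_{E\subseteq Y,|E|<\infty}E_\ast$. (That is, $\ast$ is a finitary ideal system on $R$ coarser than the system of ring ideals.) A $\ast$-ideal is a $Y\subseteq R$ with $Y_\ast=Y$; the $\ast$-product of $\ast$-ideals $I,J$ is $(IJ)_\ast$ (similarly for finitely many factors). $\ast$-$\max(R)$ is the set of maximal elements among the proper $\ast$-ideals of $R$. $I\subseteq R$ is radical if $\{x\in R: x^n\in I\text{ for some }n\ge1\}=I$. $R$ is a $\ast$-SP-domain if every $\ast$-ideal is a finite $\ast$-product of radical $\ast$-ideals. An $s$-ideal of a domain $D$ is a subset $Y$ with $Y=YD\cup\{0\}$; a domain that is not a field is a DVM if each of its $s$-ideals is principal. $R$ is $\ast$-almost Dedekind if $R=K$ or the localization $R_M$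 is a DVM for each $M\in\ast$-$\max(R)$. An SP-domain is an integral domain in which every ideal is a finite product of radical ideals. For $f\in R[X]$ let $c(f)$ be the content of $f$ (the ideal of $R$ generated by its coefficients), $N_\ast=\{g\in R[X]: c(g)_\ast=R\}$ and ${\rm Na}(R,\ast)=\{f/g: f\in R[X],\ g\in N_\ast\}$. *)

(* Defs.v *)
From HB Require Import structures.
From mathcomp Require Import all_boot all_order all_algebra fraction.
From mathcomp Require Import boolp classical_sets functions cardinality.

Set Implicit Arguments.
Unset Strict Implicit.
Unset Printing Implicit Defensive.

Import GRing.Theory.
Local Open Scope ring_scope.
Local Open Scope classical_set_scope.

Notation "x %:F" := (@FracField.tofrac _ x) : ring_scope.

(* Ideals need not be proper, contrary to MathComp's [idealr_closed]. *)
Definition is_ideal (D : idomainType) (I : set D) : Prop :=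
  [/\ I 0, forall x y, I x -> I y -> I (x + y) & forall a x, I x -> I (a * x)].

Definition ideal_gen (D : idomainType) (Y : set D) : set D :=
  smallest (@is_ideal D) Y.

Definition setmul (D : idomainType) (A B : set D) : set D :=
  [set a * b | a in A & b in B].

Definition scale_set (D : idomainType) (c : D) (Y : set D) : set D :=
  [set c * y | y in Y].

(* The elementwise product of n subsets; for n = 0 it is {1}, which generates
   the whole ring. *)
Definition setprod (D : idomainType) (n : nat) (J : 'I_n -> set D) : set D :=
  \big[@setmul D / [set 1]]_(i < n) J i.

Definition radical (D : idomainType) (I : set D) : Prop :=
  [set x | exists2 n : nat, (1 <= n)%N & I (x ^+ n)] = I.

Definition SP_domain (D : idomainType) : Prop :=
  forall I : set D, is_ideal I ->
    exists (n : nat) (J : 'I_n -> set D),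
      (forall i, is_ideal (J i) /\ radical (J i)) /\
      I = ideal_gen (setprod J).

Definition s_ideal (D : idomainType) (Y : set D) : Prop :=
  Y = setmul Y setT `|` [set 0].

Definition principal (D : idomainType) (Y : set D) : Prop :=
  exists y : D, Y = scale_set y setT.

Definition is_field (D : idomainType) : Prop :=
  forall x : D, x != 0 -> x \is a GRing.unit.

Definition DVM (D : idomainType) : Prop :=
  ~ is_field D /\ forall Y : set D, s_ideal Y -> principal Y.

Record star_operation (R : idomainType) := StarOperation {
  star_fun :> set R -> set R;
  star_ge_ideal : forall Y, ideal_gen Y `<=` star_fun Y;
  star_sub : forall Y Z, Y `<=` star_fun Z -> star_fun Y `<=` star_fun Z;
  star_scale : forall c Y, scale_set c (star_fun Y) = star_fun (scale_set c Y);
  star_finite_type : forall Y,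
    star_fun Y = \bigcup_(E in [set E | E `<=` Y /\ finite_set E]) star_fun E
}.

Definition star_ideal (R : idomainType) (star : star_operation R)
  (Y : set R) : Prop := star Y = Y.

Definition star_max (R : idomainType) (star : star_operation R)
    (M : set R) : Prop :=
  [/\ star_ideal star M, M <> setT &
      forall J, star_ideal star J -> J <> setT -> M `<=` J -> J = M].

Definition star_SP_domain (R : idomainType) (star : star_operation R) : Prop :=
  forall I : set R, star_ideal star I ->
    exists (n : nat) (J : 'I_n -> set R),
      (forall i, star_ideal star (J i) /\ radical (J i)) /\
      I = star (setprod J).

Record mulset (A : idomainType) := MulSet {
  mulset_set :> A -> Prop;
  mulset1 : mulset_set 1;
  mulsetM : forall s t, mulset_set s -> mulset_set t -> mulset_set (s * t);
  mulset_neq0 : forall s, mulset_set s -> s != 0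
}.

Definition frac_pred (A : idomainType) (S : mulset A) : {pred {fraction A}} :=
  fun x => `[< exists a s : A, S s /\ x = a%:F / s%:F >].

Lemma frac_predP (A : idomainType) (S : mulset A) (x : {fraction A}) :
  reflect (exists a s : A, S s /\ x = a%:F / s%:F) (x \in frac_pred S).
Proof. exact: asboolP. Qed.

Lemma frac_pred_subring (A : idomainType) (S : mulset A) :
  subring_closed (frac_pred S).
Proof.
have nz s : S s -> s%:F != 0 :> {fraction A}.
  by move=> Ss; rewrite tofrac_eq0 (mulset_neq0 Ss).
split.
- apply/frac_predP; exists 1, 1; split; first exact: mulset1.
  by rewrite tofrac1 divr1.
- move=> x y /frac_predP[a [s [Ss ->]]] /frac_predP[b [t [St ->]]].
  apply/frac_predP; exists (a * t - b * s), (s * t).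
  split; first exact: mulsetM.
  by rewrite -mulNr addf_div ?nz // tofracB !tofracM mulNr.
- move=> x y /frac_predP[a [s [Ss ->]]] /frac_predP[b [t [St ->]]].
  apply/frac_predP; exists (a * b), (s * t); split; first exact: mulsetM.
  by rewrite mulf_div !tofracM.
Qed.

HB.instance Definition _ (A : idomainType) (S : mulset A) :=
  GRing.isSubringClosed.Build {fraction A} (frac_pred S)
    (frac_pred_subring S).

(* The ring of fractions S^-1 A, as a subring of the quotient field of A. *)
Record localization (A : idomainType) (S : mulset A) := Localization {
  loc_val :> {fraction A};
  loc_valP : loc_val \in frac_pred S
}.

HB.instance Definition _ (A : idomainType) (S : mulset A) :=
  [isSub for @loc_val A S].
HB.instance Definition _ (A : idomainType) (S : mulset A) :=
  [Choice of localization S by <:].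
HB.instance Definition _ (A : idomainType) (S : mulset A) :=
  [SubChoice_isSubComNzRing of localization S by <:].

Definition loc_unit (A : idomainType) (S : mulset A) :
    {pred localization S} :=
  fun x => (val x != 0) && ((val x)^-1 \in frac_pred S).

Definition loc_inv (A : idomainType) (S : mulset A) (x : localization S) :
  localization S := insubd x (val x)^-1.

Lemma loc_mulVx (A : idomainType) (S : mulset A) :
  {in @loc_unit A S, left_inverse 1 (@loc_inv A S) *%R}.
Proof.
move=> x /andP[x0 xV]; apply: val_inj.
by rewrite rmorphM /= /loc_inv val_insubd xV mulVf.
Qed.

Lemma loc_unitPl (A : idomainType) (S : mulset A) (x y : localization S) :
  y * x = 1 -> loc_unit x.
Proof.
move=> yx; have yx1 : loc_val y * loc_val x = 1 := congr1 val yx.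
have x0 : loc_val x != 0.
  apply/eqP => x0; move: yx1; rewrite x0 mulr0 => /eqP.
  by rewrite eq_sym oner_eq0.
apply/andP; split; first exact: x0.
rewrite /= (_ : (loc_val x)^-1 = loc_val y); first exact: loc_valP.
by apply: (mulIf x0); rewrite mulVf // yx1.
Qed.

Lemma loc_invr_out (A : idomainType) (S : mulset A) :
  {in [predC @loc_unit A S], @loc_inv A S =1 id}.
Proof.
move=> x; rewrite inE /= negb_and negbK => /orP[/eqP x0|xV];
  apply: val_inj; rewrite /loc_inv val_insubd.
  by rewrite x0 invr0 if_same.
by rewrite (negbTE xV).
Qed.

HB.instance Definition _ (A : idomainType) (S : mulset A) :=
  GRing.ComNzRing_hasMulInverse.Build (localization S)
    (@loc_mulVx A S) (@loc_unitPl A S) (@loc_invr_out A S).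

Lemma loc_integral (A : idomainType) (S : mulset A) :
  GRing.integral_domain_axiom (localization S).
Proof.
move=> x y /(congr1 val); rewrite rmorphM rmorph0 => /eqP.
by rewrite mulf_eq0 => /orP[] /eqP h; apply/orP; [left|right];
  apply/eqP/val_inj.
Qed.

HB.instance Definition _ (A : idomainType) (S : mulset A) :=
  GRing.ComUnitRing_isIntegral.Build (localization S) (@loc_integral A S).

Lemma sub_star (R : idomainType) (star : star_operation R) (Y : set R) :
  Y `<=` star Y.
Proof.
by move=> y Yy; apply: star_ge_ideal => I [_]; apply.
Qed.

Lemma star_mono (R : idomainType) (star : star_operation R) (Y Z : set R) :
  Y `<=` Z -> star Y `<=` star Z.
Proof. by move=> YZ; apply: star_sub => y /YZ; apply: sub_star. Qed.

Lemma star_idem (R : idomainType) (star : star_operation R) (Y : set R) :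
  star_ideal star (star Y).
Proof. by apply/seteqP; split; [exact: star_sub|exact: sub_star]. Qed.

Lemma star_is_ideal (R : idomainType) (star : star_operation R) (Y : set R) :
  is_ideal (star Y).
Proof.
have H Z : Z `<=` star Y -> ideal_gen Z `<=` star Y.
  by move=> ZY; apply: subset_trans (star_sub ZY); exact: star_ge_ideal.
split.
- by apply: (H set0) => // I [[]].
- move=> x y Yx Yy; apply: (H [set x; y]) => [z [->|->] //|].
  by move=> I [[_ ID _] xyI]; apply: ID; apply: xyI; [left|right].
- move=> a x Yx; apply: (H [set x]) => [z -> //|].
  by move=> I [[_ _ IM] xI]; apply: IM; apply: xI.
Qed.

Lemma star_ideal_is_ideal (R : idomainType) (star : star_operation R)
  (Y : set R) : star_ideal star Y -> is_ideal Y.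
Proof. by move=> <-; exact: star_is_ideal. Qed.

Lemma is_ideal1 (D : idomainType) (I : set D) : is_ideal I -> I 1 -> I = setT.
Proof.
move=> [_ _ IM] I1; apply/seteqP; split=> // x _.
by rewrite -(mulr1 x); apply: IM.
Qed.

Lemma star_max_prime (R : idomainType) (star : star_operation R) (M : set R) :
  star_max star M -> forall a b, M (a * b) -> M a \/ M b.
Proof.
move=> [Mst MT Mmax] a b Mab; apply/or_asboolP; rewrite -[_ || _]negbK.
apply/negP; rewrite negb_or => /andP[/asboolP Ma /asboolP Mb].
have [M0 MD MM] := star_ideal_is_ideal Mst.
have big c : ~ M c -> star (M `|` [set c]) 1.
  move=> Mc; set J := star _.
  have MJ : M `<=` J by move=> x Mx; apply: sub_star; left.
  have Jc : J c by apply: sub_star; right.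
  have [->//|JT] := pselect (J = setT).
  by case: Mc; rewrite -(Mmax J (star_idem _ _) JT MJ).
have Msc c d Y : star Y d -> scale_set c Y `<=` M -> M (c * d).
  move=> Yd cY; rewrite -Mst; apply: (star_mono cY).
  by rewrite -star_scale; exists d.
apply: Mb; rewrite -[b]mulr1; apply: Msc (big a Ma) _ => _ [x [Mx|->] <-].
  exact: MM.
by rewrite mulrC.
Qed.

Lemma star_max_not1 (R : idomainType) (star : star_operation R) (M : set R) :
  star_max star M -> (~` M) 1.
Proof.
by move=> [Mst MT _] M1; apply: MT; apply: is_ideal1 (star_ideal_is_ideal Mst) M1.
Qed.

Lemma star_max_notM (R : idomainType) (star : star_operation R) (M : set R) :
  star_max star M -> forall s t, (~` M) s -> (~` M) t -> (~` M) (s * t).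
Proof. by move=> Mmax s t Ms Mt /(star_max_prime Mmax)[]. Qed.

Lemma star_max_notN0 (R : idomainType) (star : star_operation R) (M : set R) :
  star_max star M -> forall s, (~` M) s -> s != 0.
Proof.
move=> [Mst _ _] s Ms; apply/eqP => s0; apply: Ms; rewrite s0.
by have [] := star_ideal_is_ideal Mst.
Qed.

Definition star_max_compl (R : idomainType) (star : star_operation R)
    (M : set R) (HM : star_max star M) : mulset R :=
  @MulSet R (~` M) (star_max_not1 HM) (star_max_notM HM)
    (star_max_notN0 HM).

(* The first alternative is R = K, for K the field of quotients of R. *)
Definition star_almost_Dedekind (R : idomainType) (star : star_operation R) :
    Prop :=
  range (fun a : R => a%:F) = [set: {fraction R}] \/
  forall (M : set R) (HM : star_max star M),
    DVM (localization (star_max_compl HM)).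

Definition content (R : idomainType) (f : {poly R}) : set R :=
  ideal_gen (range (fun i : nat => f`_i)).

Definition N_star (R : idomainType) (star : star_operation R) :
  set {poly R} := [set g | star (content g) = setT].

Lemma star_max_exists (R : idomainType) (star : star_operation R)
  (I : set R) : ~ star I 1 -> exists2 M, star_max star M & I `<=` M.
Proof.
move=> I1.
pose P : set (set R) := [set Y | ~ star (Y `|` I) 1].
have chain F : F `<=` P -> total_on F subset -> P (\bigcup_(X in F) X).
  move=> FP Ftot; rewrite /P /= star_finite_type => -[E [EF finE]] E1.
  have [Y [YP EY]] : exists Y, P Y /\ E `<=` Y `|` I.
    have [[X0 FX0]|F0] := pselect (exists X, F X); last first.
      exists set0; split; first by rewrite /P /= set0U.
      by move=> x /EF[[X FX]|Ix]; [case: F0; exists X|right].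
    suff [X FX EX] : exists2 X, F X & E `<=` X `|` I.
      by exists X; split => //; apply: FP.
    have /finite_seqP[s Es] := finE; rewrite {finE E1}Es in EF *.
    elim: s EF => [|x s IHs] sF; first by exists X0.
    have [|X FX sX] := IHs.
      by move=> y ys; apply: sF; rewrite /= inE; apply/orP; right.
    have [|[Z FZ Zx]|Ix] := sF x; first by rewrite /= inE eqxx.
    - have [XZ|ZX] := Ftot _ _ FX FZ.
        exists Z => // y; rewrite /= inE => /orP[/eqP->|/sX]; first by left.
        by case=> [/XZ|]; [left|right].
      exists X => // y; rewrite /= inE => /orP[/eqP->|/sX //].
      by left; apply: ZX.
    - exists X => // y; rewrite /= inE => /orP[/eqP->|/sX //].
      by right.
  by apply: YP; apply: star_mono EY _ _.
have [A [PA maxA]] := Zorn_bigcup chain.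
pose M := star (A `|` I).
have PM Y : star_ideal star Y -> ~ Y 1 -> I `<=` Y -> P Y.
  by move=> Yst Y1 IY; rewrite /P /= (_ : Y `|` I = Y) ?Yst //; apply/setUidl.
have AM : A `<=` M by move=> x Ax; apply: sub_star; left.
have IM : I `<=` M by move=> x Ix; apply: sub_star; right.
exists M => //; split; first exact: star_idem.
  by move=> MT; apply: PA; rewrite -/M MT.
move=> J Jst JT MJ.
have PJ : P J.
  apply: PM => //; last exact: subset_trans MJ.
  by move=> /(is_ideal1 (star_ideal_is_ideal Jst)).
apply/seteqP; split => //; apply: contrapT => JM.
apply: (maxA J) PJ; split; first exact: subset_trans MJ.
by move=> JA; apply: JM; exact: subset_trans AM.
Qed.

Lemma content_coef (R : idomainType) (f : {poly R}) (i : nat) :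
  content f f`_i.
Proof. by move=> I [_]; apply; exists i. Qed.

Lemma content_sub (R : idomainType) (f : {poly R}) (I : set R) :
  is_ideal I -> (forall i, I f`_i) -> content f `<=` I.
Proof. by move=> Iid If x; apply; split => // _ [i _ <-]. Qed.

Lemma is_ideal_sum (D : idomainType) (I : set D) (T : Type) (s : seq T)
    (P : pred T) (F : T -> D) :
  is_ideal I -> (forall i, P i -> I (F i)) -> I (\sum_(i <- s | P i) F i).
Proof. by move=> [I0 ID _]; apply: (big_ind I). Qed.

Lemma star_max_content (R : idomainType) (star : star_operation R)
    (M : set R) (f g : {poly R}) :
  star_max star M -> (exists i, ~ M f`_i) -> (exists j, ~ M g`_j) ->
  exists k, ~ M (f * g)`_k.
Proof.
move=> Mmax exf exg; have [Mst _ _] := Mmax.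
have Mid := star_ideal_is_ideal Mst; have [M0 MD MM] := Mid.
have first_coef (h : {poly R}) : (exists i, ~ M h`_i) ->
    exists2 i, ~ M h`_i & forall j, (j < i)%N -> M h`_j.
  move=> [i hi].
  have ex : exists i, ~~ `[< M h`_i >] by exists i; apply/asboolPn.
  exists (ex_minn ex); case: ex_minnP => k /asboolPn hk kmin //.
  move=> j jk; apply: contrapT => /asboolPn/kmin.
  by rewrite leqNgt jk.
have [i fi fmin] := first_coef f exf.
have [j gj gmin] := first_coef g exg.
exists (i + j)%N; rewrite coefM.
have ilt : (i < (i + j).+1)%N by rewrite ltnS leq_addr.
rewrite (bigD1 (Ordinal ilt)) //= addKn.
set rest := \sum_(_ < _ | _) _ => Mfg.
have Mrest : M rest.
  apply: is_ideal_sum => // k; rewrite -val_eqE /= => ki.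
  have [/fmin fk|ik|ki'] := ltngtP k i.
  - by rewrite mulrC; apply: MM.
  - apply: MM; apply: gmin; have := ltn_ord k; rewrite ltnS => kij.
    by rewrite ltn_subLR // ltn_add2r.
  - by rewrite ki' eqxx in ki.
have : M (f`_i * g`_j).
  rewrite -[f`_i * _](addrK rest) -mulN1r.
  by apply: MD => //; apply: MM.
by case/(star_max_prime Mmax).
Qed.

Lemma N_star1 (R : idomainType) (star : star_operation R) : N_star star 1.
Proof.
apply: is_ideal1; first exact: star_is_ideal.
by apply: sub_star; have := @content_coef R 1 0; rewrite coef1.
Qed.

Lemma N_starM (R : idomainType) (star : star_operation R) (f g : {poly R}) :
  N_star star f -> N_star star g -> N_star star (f * g).
Proof.
move=> Nf Ng; apply: is_ideal1; first exact: star_is_ideal.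
apply: contrapT => /star_max_exists[M Mmax fgM].
have [Mst MT _] := Mmax.
have some_coef h : N_star star h -> exists i, ~ M h`_i.
  move=> Nh; apply: contrapT => hM; apply: MT.
  apply/seteqP; split => // x _; rewrite -Mst.
  have: star (content h) x by rewrite Nh.
  apply: star_mono; apply: content_sub (star_ideal_is_ideal Mst) _ => i.
  by apply: contrapT => Mhi; apply: hM; exists i.
have [k] := star_max_content Mmax (some_coef f Nf) (some_coef g Ng).
by apply; apply: fgM; exact: content_coef.
Qed.

Lemma N_star_neq0 (R : idomainType) (star : star_operation R)
  (g : {poly R}) : N_star star g -> g != 0.
Proof.
move=> Ng; apply/eqP => g0; rewrite {}g0 in Ng.
have: star (content (0 : {poly R})) 1 by rewrite Ng.
have /star_mono h : content (0 : {poly R}) `<=` scale_set 0 setT.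
  apply: content_sub => [|i]; last by exists 0; rewrite // mul0r coef0.
  split; first by exists 0; rewrite ?mul0r.
    by move=> _ _ [x _ <-] [y _ <-]; exists (x + y); rewrite ?mulrDr.
  by move=> a _ [x _ <-]; exists x; rewrite // !mul0r mulr0.
move=> /(h star); rewrite -star_scale => -[x _] /eqP.
by rewrite mul0r eq_sym oner_eq0.
Qed.

Definition Nagata_mulset (R : idomainType) (star : star_operation R) :
    mulset {poly R} :=
  @MulSet {poly R} (N_star star) (N_star1 star) (@N_starM R star)
    (@N_star_neq0 R star).

Definition Na (R : idomainType) (star : star_operation R) : idomainType :=
  localization (Nagata_mulset star).

(* Main.v *)
Require Import Defs.
From HB Require Import structures.
From mathcomp Require Import all_boot all_algebra.
From mathcomp Require Import fraction ring generic_quotient.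
From mathcomp Require Import boolp classical_sets cardinality.

Set Implicit Arguments.
Unset Strict Implicit.
Unset Printing Implicit Defensive.

Import GRing.Theory.
Local Open Scope ring_scope.
Local Open Scope classical_set_scope.

(** Write T for the Nagata ring and [U ∩ R] for the contraction to R of an
    ideal U of T.

    Two facts carry the theorem.  The first compares ideals of R and T: assume
    that every localization of R at a maximal star ideal M is a valuation domain
    ([locally_valuation]).  A finite set then generates a principal ideal
    locally at M, so an element of [star I] lies in I locally at every M
    ([star_locally]); and a coefficient of a polynomial f is, locally at every
    M[X], a multiple of f.  An ideal of R[X] contained in no M[X] meets N_star
    ([ideal_meets_N_star]), since finitely many polynomials can be combined by
    shifts into one whose coefficients are all of theirs.  Hence membership in
    an ideal of T is a local question ([Na_local_mem]): contractions of ideals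
    of T are star ideals, each coefficient of f lies in f T ([coef_dvd_Na]),
    and [I |-> I T] and [U |-> U ∩ R] are inverse bijections between star
    ideals of R and ideals of T that match products and radical ideals.  So the
    factorization property holds on one side exactly when it holds on the other
    ([star_SP_iff_Na_SP]).

    The second fact is that an SP-domain is almost Dedekind: a local SP-domain
    D which is not a field has a principal maximal ideal [x D], and each nonzero
    element is a unit times a power of x ([SP_local_uniformizer]).  The property
    passes to localizations ([SP_localizing]).  First let Q be minimal over
    a nonzero finitely generated ideal A.  In D_Q a radical ideal that contains
    a power of A is Q or the whole ring, so A, and every other ideal with the
    same radical, is a power of Q; Nakayama's lemma then makes Q principal
    ([fg_primary_principal]).  Now let x D be radical with x nonzero.  If x were
    in N^2 for a proper ideal N, it would be in A^2 for a finitely generated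
    A inside N, hence divisible by a square of a nonunit in some D_Q, which
    radicality forbids ([radical_notin_square]).  Consequently every proper
    ideal of the local domain D that contains x has only one proper factor and
    is radical.  For a nonunit y this applies to [(x, y^2)]: it contains y, so
    [y (1 - y t)] is in [x D] and x divides y.  A nonunit x with x D radical
    exists because the factors of a principal ideal are principal.

    Applied to R[X] localized at the complement of M[X], which is a localization
    of T, the second fact gives an order function there; its restriction to R
    shows that R_M is a DVM unless R is a field ([SP_DVM]), and the first fact
    then applies in both directions. *)

(** * Ideals and their products *)

Section Ideals.
Variable D : idomainType.
Implicit Types (A B I J Y Z : set D) (x y z : D).

Lemma ideal_gen_ideal Y : is_ideal (ideal_gen Y).
Proof.
split=> [I [[I0 _ _] _] //|x y Yx Yy I HI|a x Yx I HI].
- by have [[_ ID _] _] := HI; apply: ID; [apply: Yx|apply: Yy].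
- by have [[_ _ IM] _] := HI; apply: IM; apply: Yx.
Qed.

Lemma sub_ideal_gen Y : Y `<=` ideal_gen Y.
Proof. exact: sub_smallest. Qed.

Lemma ideal_gen_sub Y I : is_ideal I -> Y `<=` I -> ideal_gen Y `<=` I.
Proof. exact: smallest_sub. Qed.

Lemma ideal_gen_id I : is_ideal I -> ideal_gen I = I.
Proof.
by move=> Iid; apply/seteqP; split; [exact: ideal_gen_sub|exact: sub_ideal_gen].
Qed.

Lemma ideal_setT : is_ideal [set: D].
Proof. by split. Qed.

Lemma principal_ideal x : is_ideal (scale_set x setT).
Proof.
split=> [|_ _ [a _ <-] [b _ <-]|a _ [b _ <-]].
- by exists 0; rewrite ?mulr0.
- by exists (a + b); rewrite ?mulrDr.
- by exists (a * b); rewrite // mulrCA.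
Qed.

Definition isum I J : set D := [set z | exists x y, [/\ I x, J y & z = x + y]].

Lemma isum_ideal I J : is_ideal I -> is_ideal J -> is_ideal (isum I J).
Proof.
move=> [I0 ID IM] [J0 JD JM]; split.
- by exists 0, 0; rewrite addr0.
- move=> _ _ [x [y [Ix Jy ->]]] [x' [y' [Ix' Jy' ->]]].
  by exists (x + x'), (y + y'); split; [exact: ID|exact: JD|ring].
- move=> a _ [x [y [Ix Jy ->]]].
  by exists (a * x), (a * y); split; [exact: IM|exact: JM|ring].
Qed.

Lemma isum_l I J : is_ideal J -> I `<=` isum I J.
Proof. by move=> [J0 _ _] x Ix; exists x, 0; rewrite addr0. Qed.

Lemma isum_r I J : is_ideal I -> J `<=` isum I J.
Proof. by move=> [I0 _ _] x Ix; exists 0, x; rewrite add0r. Qed.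

Definition imul I J : set D := ideal_gen (setmul I J).

Lemma imul_ideal I J : is_ideal (imul I J).
Proof. exact: ideal_gen_ideal. Qed.

Lemma mem_imul I J x y : I x -> J y -> imul I J (x * y).
Proof. by move=> Ix Jy; apply: sub_ideal_gen; exists x => //; exists y. Qed.

Lemma imul_sub I J A : is_ideal A ->
  (forall x y, I x -> J y -> A (x * y)) -> imul I J `<=` A.
Proof.
by move=> Aid IJA; apply: ideal_gen_sub => // _ [x Ix [y Jy <-]]; apply: IJA.
Qed.

Lemma imulS I I' J J' : I `<=` I' -> J `<=` J' -> imul I J `<=` imul I' J'.
Proof.
move=> II JJ; apply: imul_sub (imul_ideal _ _) _ => x y /II Ix /JJ.
exact: mem_imul.
Qed.

Lemma imul_subl I J : is_ideal I -> imul I J `<=` I.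
Proof.
move=> Iid; apply: imul_sub => // x y Ix _.
by case: Iid => _ _ IM; rewrite mulrC; apply: IM.
Qed.

Lemma imul_subr I J : is_ideal J -> imul I J `<=` J.
Proof. by move=> Jid; apply: imul_sub => // x y _; case: Jid => _ _; apply. Qed.

Lemma imul1I I : is_ideal I -> imul setT I = I.
Proof.
move=> Iid; apply/seteqP; split; first exact: imul_subr.
by move=> x Ix; rewrite -[x]mul1r; apply: mem_imul.
Qed.

Lemma imulI1 I : is_ideal I -> imul I setT = I.
Proof.
move=> Iid; apply/seteqP; split; first exact: imul_subl.
by move=> x Ix; rewrite -[x]mulr1; apply: mem_imul.
Qed.

Lemma radicalP I x n : radical I -> I (x ^+ n.+1) -> I x.
Proof. by move=> rI Ixn; rewrite -rI; exists n.+1. Qed.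

Lemma radicalI I : (forall x n, I (x ^+ n.+1) -> I x) -> radical I.
Proof.
move=> H; apply/seteqP; split=> [x [[//|n] _ /H//]|x Ix].
by exists 1%N; rewrite ?expr1.
Qed.

Lemma expr_in_ideal I x n m : is_ideal I -> I (x ^+ n) -> (n <= m)%N ->
  I (x ^+ m).
Proof. by move=> [_ _ IM] Ixn nm; rewrite -(subnK nm) exprD; apply: IM. Qed.

End Ideals.

(** * Finite products of radical ideals *)

Section Radprod.
Variables (D : idomainType) (cl : set D -> set D).

(** What [ideal_gen] and a star operation have in common; it lets one inductive
    predicate describe the factorizations on both sides of the equivalence. *)
Definition ideal_closure : Prop :=
  [/\ forall Y, Y `<=` cl Y,
      forall Y Z, Y `<=` cl Z -> cl Y `<=` cl Z &
      forall c Y, scale_set c (cl Y) `<=` cl (scale_set c Y)].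

(** Closing after each factor gives the same sets as closing the whole product
    once, and makes factorizations accessible to induction. *)
Inductive radprod : set D -> Prop :=
| radprod1 : radprod (cl [set 1])
| radprodM J I : cl J = J -> radical J -> radprod I ->
    radprod (cl (setmul J I)).

Hypothesis clP : ideal_closure.

Lemma radprod_closed I : radprod I -> cl I = I.
Proof.
have [sub cls _] := clP.
have idem Y : cl (cl Y) = cl Y.
  by apply/seteqP; split; [exact: cls|exact: sub].
by case.
Qed.

Lemma closure_mulr A B : cl (setmul A (cl B)) = cl (setmul A B).
Proof.
have [clsub cls scl] := clP; apply/seteqP; split; apply: (cls).
  move=> _ [a Aa [b Bb <-]].
  suff: cl (scale_set a B) (a * b).
    apply: (cls) => _ [c Bc <-]; apply: (clsub).
    by exists a => //; exists c.
  by apply: (scl); exists b.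
move=> _ [a Aa [b Bb <-]]; apply: (clsub); exists a => //; exists b => //.
exact: clsub.
Qed.

Lemma radprodP I :
  (exists (n : nat) (J : 'I_n -> set D),
    (forall i, cl (J i) = J i /\ radical (J i)) /\ I = cl (setprod J))
  <-> radprod I.
Proof.
split=> [[n [J [HJ ->]]]|].
  elim: n J HJ => [|n IHn] J HJ.
    by rewrite /setprod big_ord0; apply: radprod1.
  rewrite /setprod big_ord_recl -closure_mulr.
  apply: radprodM; [by case: (HJ ord0)..|].
  by apply: IHn => i; apply: HJ.
elim=> {I} [|J I clJ rJ _ [n [J' [HJ' ->]]]].
  by exists 0, (fun=> setT); split; [case|rewrite /setprod big_ord0].
exists n.+1, (fun i => if unlift ord0 i is Some j then J' j else J).
split=> [i|]; first by case: unliftP.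
rewrite closure_mulr /setprod big_ord_recl unlift_none.
by congr (cl (setmul _ _)); apply: eq_bigr => i _; rewrite liftK.
Qed.

End Radprod.

Lemma ideal_gen_closure (D : idomainType) : ideal_closure (@ideal_gen D).
Proof.
split=> [Y|Y Z YZ|c Y]; first exact: sub_ideal_gen.
  by apply: ideal_gen_sub => //; apply: ideal_gen_ideal.
move=> _ [y Yy <-]; move: y Yy.
have [G0 GD GM] := ideal_gen_ideal (scale_set c Y).
apply: (@ideal_gen_sub _ _ [set y | ideal_gen (scale_set c Y) (c * y)]).
  split=> [|x y cx cy|a x cx] /=; first by rewrite mulr0.
    by rewrite mulrDr; apply: GD.
  by rewrite mulrCA; apply: GM.
by move=> y Yy; apply: sub_ideal_gen; exists y.
Qed.

Lemma star_closure (R : idomainType) (star : star_operation R) :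
  ideal_closure star.
Proof.
split=> [Y|Y Z|c Y]; [exact: sub_star|exact: star_sub|].
by rewrite star_scale.
Qed.

Lemma SP_domainP (D : idomainType) :
  SP_domain D <-> forall I : set D, is_ideal I -> radprod (@ideal_gen D) I.
Proof.
have key I (n : nat) (J : 'I_n -> set D) :
    ((forall i, is_ideal (J i) /\ radical (J i)) /\ I = ideal_gen (setprod J))
    <-> ((forall i, ideal_gen (J i) = J i /\ radical (J i)) /\
         I = ideal_gen (setprod J)).
  split=> -[HJ ->]; split=> // i; have [J1 J2] := HJ i; split=> //.
    exact: ideal_gen_id.
  by rewrite -J1; apply: ideal_gen_ideal.
split=> H I Iid.
  have [n [J /key HJ]] := H I Iid.
  by apply/(radprodP (@ideal_gen_closure D)); exists n, J.
have /(radprodP (@ideal_gen_closure D))[n [J /key HJ]] := H I Iid.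
by exists n, J.
Qed.

Lemma star_SP_domainP (R : idomainType) (star : star_operation R) :
  star_SP_domain star <-> forall I, star_ideal star I -> radprod star I.
Proof.
by split=> H I /H /(radprodP (star_closure star)).
Qed.

Lemma radprod_ideal (D : idomainType) (I : set D) :
  radprod (@ideal_gen D) I -> is_ideal I.
Proof.
move=> /(radprod_closed (@ideal_gen_closure D)) <-; exact: ideal_gen_ideal.
Qed.

Lemma ideal_gen1 (D : idomainType) : ideal_gen [set 1] = [set: D].
Proof.
by apply: is_ideal1 (ideal_gen_ideal _) _; apply: sub_ideal_gen.
Qed.

(** * Localization *)

Section Localizing.
Variables (D L : idomainType) (phi : {rmorphism D -> L}).

(** [L] is the ring of fractions of [D] at the elements that [phi] makes
    invertible.  The canonical maps into rings of fractions and the inclusions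
    between such rings are both of this kind. *)
Definition localizing : Prop :=
  injective phi /\
  forall y, exists s a, phi s \is a GRing.unit /\ phi s * y = phi a.

Hypothesis phiP : localizing.

Definition ext (B : set D) : set L :=
  [set y | exists s b, [/\ phi s \is a GRing.unit, B b & phi s * y = phi b]].

Lemma contraction_ideal (U : set L) : is_ideal U -> is_ideal (phi @^-1` U).
Proof.
move=> [U0 UD UM]; split=> [|x y Ux Uy|a x Ux] /=.
- by rewrite rmorph0.
- by rewrite rmorphD; apply: UD.
- by rewrite rmorphM; apply: UM.
Qed.

Lemma ext_mem B b : B b -> ext B (phi b).
Proof. by move=> Bb; exists 1, b; rewrite rmorph1 unitr1 mul1r. Qed.

Lemma ext_ideal B : is_ideal B -> is_ideal (ext B).
Proof.
move=> [B0 BD BM]; split.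
- by exists 1, 0; rewrite rmorph1 unitr1 mulr0 rmorph0.
- move=> x y [s [b [su Bb sb]]] [t [c [tu Bc tc]]].
  exists (s * t), (t * b + s * c); split.
  + by rewrite rmorphM unitrM su.
  + by apply: BD; apply: BM.
  + by rewrite rmorphD !rmorphM -sb -tc; ring.
- move=> a x [s [b [su Bb sb]]].
  have [_ /(_ a)[t [c [tu tc]]]] := phiP.
  exists (t * s), (c * b); split; last by rewrite !rmorphM -tc -sb; ring.
    by rewrite rmorphM unitrM tu.
  exact: BM.
Qed.

Lemma ext_sub B (U : set L) : is_ideal U -> (forall b, B b -> U (phi b)) ->
  ext B `<=` U.
Proof.
move=> [_ _ UM] BU y [s [b [su /BU Ub sb]]].
by rewrite -[y](mulKr su) sb; apply: UM.
Qed.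

Lemma ext_contraction (U : set L) : is_ideal U -> ext (phi @^-1` U) = U.
Proof.
move=> Uid; apply/seteqP; split; first exact: ext_sub.
move=> y Uy; have [_ /(_ y)[s [a [su sa]]]] := phiP.
by exists s, a; split=> //=; rewrite -sa; case: Uid => _ _; apply.
Qed.

Lemma ext_imul (I J : set D) : is_ideal I -> is_ideal J ->
  ext (imul I J) = imul (ext I) (ext J).
Proof.
move=> Iid Jid; apply/seteqP; split.
  apply: ext_sub; first exact: imul_ideal.
  apply: imul_sub; first exact/contraction_ideal/imul_ideal.
  move=> x y Ix Jy /=; rewrite rmorphM.
  by apply: mem_imul; apply: ext_mem.
apply: imul_sub; first exact/ext_ideal/imul_ideal.
move=> x y [s [b [su Ib sb]]] [t [c [tu Jc tc]]].
exists (s * t), (b * c); split; first by rewrite rmorphM unitrM su.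
  exact: mem_imul.
by rewrite !rmorphM -sb -tc; ring.
Qed.

Lemma ext_radical (I : set D) : is_ideal I -> radical I -> radical (ext I).
Proof.
move=> Iid rI; have [_ _ IM] := Iid; have [inj phiq] := phiP.
apply: radicalI => y n [s [b [su Ib sb]]].
have [t [a [tu ta]]] := phiq y.
exists (s * t), (s * a); split; first by rewrite rmorphM unitrM su.
  apply: (@radicalP _ _ _ n) => //.
  suff <-: s ^+ n * t ^+ n.+1 * b = (s * a) ^+ n.+1 by apply: IM.
  apply: inj; rewrite !(rmorphM, rmorphXn) /= -ta -sb !exprMn.
  by rewrite [phi s ^+ n.+1]exprSr; ring.
by rewrite !rmorphM -ta; ring.
Qed.

(** Every ideal of [L] is extended from its contraction, and extension
    preserves products and radical ideals. *)
Lemma SP_localizing : SP_domain D -> SP_domain L.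
Proof.
move=> /SP_domainP spD; apply/SP_domainP => U Uid.
rewrite -(ext_contraction Uid).
elim: (spD _ (contraction_ideal Uid)) => {U Uid} [|J I Jid rJ rpI IH].
  suff ->: ext (ideal_gen [set 1]) = ideal_gen [set 1] by exact: radprod1.
  rewrite !ideal_gen1; apply: is_ideal1; first exact/ext_ideal/ideal_setT.
  by rewrite -(rmorph1 phi); apply: ext_mem.
have Jd : is_ideal J by rewrite -Jid; apply: ideal_gen_ideal.
rewrite -/(imul J I) ext_imul //; last exact: radprod_ideal.
by apply: radprodM => //; [exact/ideal_gen_id/ext_ideal|exact: ext_radical].
Qed.

End Localizing.

Section LocIn.
Variables (A : idomainType) (S : mulset A).

Lemma loc_in_subproof (a : A) : a%:F \in frac_pred S.
Proof.
apply/frac_predP; exists a, 1; rewrite tofrac1 divr1; split=> //.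
exact: mulset1.
Qed.

Definition loc_in (a : A) : localization S := Localization (loc_in_subproof a).

Fact loc_in_is_additive : zmod_morphism loc_in.
Proof. by move=> a b; apply: val_inj; rewrite rmorphB /= tofracB. Qed.

Fact loc_in_is_multiplicative : monoid_morphism loc_in.
Proof.
by split=> [|a b]; apply: val_inj;
  rewrite ?rmorph1 ?rmorphM /= ?tofrac1 ?tofracM.
Qed.

HB.instance Definition _ :=
  GRing.isZmodMorphism.Build A (localization S) loc_in loc_in_is_additive.
HB.instance Definition _ :=
  GRing.isMonoidMorphism.Build A (localization S) loc_in
    loc_in_is_multiplicative.

Lemma loc_in_inj : injective loc_in.
Proof. by move=> a b /(congr1 val) /= /eqP; rewrite tofrac_eq => /eqP. Qed.

Lemma loc_in_unit s : S s -> loc_in s \is a GRing.unit.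
Proof.
move=> Ss; apply/andP; split => /=.
  by rewrite tofrac_eq0 (mulset_neq0 Ss).
by apply/frac_predP; exists 1, s; rewrite tofrac1 div1r.
Qed.

Lemma loc_inP (y : localization S) :
  exists s a, S s /\ loc_in s * y = loc_in a.
Proof.
have /frac_predP[a [s [Ss e]]] := loc_valP y.
exists s, a; split=> //; apply: val_inj; rewrite rmorphM /= e mulrC divfK //.
by rewrite tofrac_eq0 (mulset_neq0 Ss).
Qed.

Lemma loc_in_localizing : localizing loc_in.
Proof.
split=> [|y]; first exact: loc_in_inj.
have [s [a [Ss e]]] := loc_inP y.
by exists s, a; split=> //; apply: loc_in_unit.
Qed.

End LocIn.

Section LocIncl.
Variables (A : idomainType) (S S' : mulset A).
Hypothesis SS' : forall s, S s -> S' s.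

Lemma loc_incl_subproof (y : localization S) : val y \in frac_pred S'.
Proof.
have /frac_predP[a [s [Ss e]]] := loc_valP y.
by apply/frac_predP; exists a, s; split=> //; apply: SS'.
Qed.

Definition loc_incl (y : localization S) : localization S' :=
  Localization (loc_incl_subproof y).

Fact loc_incl_is_additive : zmod_morphism loc_incl.
Proof.
by move=> a b; apply: val_inj; rewrite rmorphB; exact: (rmorphB \val a b).
Qed.

Fact loc_incl_is_multiplicative : monoid_morphism loc_incl.
Proof.
split=> [|a b]; apply: val_inj.
  by rewrite rmorph1; exact: (rmorph1 \val).
by rewrite rmorphM; exact: (rmorphM \val a b).
Qed.

HB.instance Definition _ :=
  GRing.isZmodMorphism.Build (localization S) (localization S') loc_incl
    loc_incl_is_additive.
HB.instance Definition _ :=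
  GRing.isMonoidMorphism.Build (localization S) (localization S') loc_incl
    loc_incl_is_multiplicative.

Lemma loc_incl_localizing : localizing loc_incl.
Proof.
split=> [x y /(congr1 val) /= e|y]; first exact: val_inj.
have [s [a [Ss e]]] := loc_inP y.
have inE b : loc_incl (loc_in S b) = loc_in S' b by apply: val_inj.
exists (loc_in S s), (loc_in S a); rewrite /= !inE.
by split=> //; apply: loc_in_unit.
Qed.

End LocIncl.

(** * Local domains *)

Section LocalDomain.
Variable D : idomainType.
Implicit Types (A B I J N : set D) (x y z : D).

Definition nonunits : set D := [set x | x \isn't a GRing.unit].

Lemma nonunitsM a x : nonunits x -> nonunits (a * x).
Proof. by rewrite /nonunits /= unitrM negb_and => ->; rewrite orbT. Qed.

Lemma ideal_unit I u : is_ideal I -> u \is a GRing.unit -> I u -> I = setT.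
Proof.
move=> Iid uu Iu; apply: is_ideal1 => //; rewrite -(mulVr uu).
by case: Iid => _ _; apply.
Qed.

Lemma proper_sub_nonunits I : is_ideal I -> I = setT \/ I `<=` nonunits.
Proof.
move=> Iid; have [->|nI] := pselect (I = setT); [by left|right=> x Ix].
by apply/negP => xu; apply/nI/(ideal_unit Iid xu).
Qed.

Lemma colon_ideal I y : is_ideal I -> is_ideal [set x | I (x * y)].
Proof.
move=> [I0 ID IM]; split=> [|a b Ia Ib|a b Ib] /=; first by rewrite mul0r.
  by rewrite mulrDl; apply: ID.
by rewrite -mulrA; apply: IM.
Qed.

Lemma imulA_sub A B I : imul (imul A B) I `<=` imul A (imul B I).
Proof.
have T := imul_ideal A (imul B I).
apply: imul_sub => // x y Ax Iy; move: x Ax.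
apply: (imul_sub (colon_ideal y T)) => a b Aa Bb /=.
by rewrite -mulrA; do 2!apply: mem_imul => //.
Qed.

Fixpoint ipow I (k : nat) : set D :=
  if k is k'.+1 then imul I (ipow I k') else setT.

Lemma ipow_ideal I k : is_ideal (ipow I k).
Proof. by case: k => [|k]; [exact: ideal_setT|exact: imul_ideal]. Qed.

Lemma mem_ipow I x k : I x -> ipow I k (x ^+ k).
Proof. by move=> Ix; elim: k => // k IH; rewrite exprS; apply: mem_imul. Qed.

(** The square of [z * w] is a multiple of [x], so [x = z ^+ 2 * w] divides
    [z * w]. *)
Lemma radical_squarefree x z w : radical (scale_set x setT) -> x != 0 ->
  x = z ^+ 2 * w -> z \is a GRing.unit.
Proof.
move=> rx x0 xE; have : scale_set x setT (z * w).
  by apply: (@radicalP _ _ _ 1) => //; exists w; rewrite // xE; ring.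
case=> r _; rewrite xE => /eqP; rewrite -subr_eq0.
have -> : z ^+ 2 * w * r - z * w = z * w * (z * r - 1) by ring.
rewrite mulf_eq0 subr_eq0 => /orP[/eqP zw|/eqP zr].
  by move: x0; rewrite xE expr2 -mulrA zw mulr0 eqxx.
by apply/unitrPr; exists r.
Qed.

Lemma nilpotent_mod_add I x y n m : is_ideal I ->
  I (x ^+ n) -> I (y ^+ m) -> I ((x + y) ^+ (n + m)).
Proof.
move=> Iid In Im; rewrite exprDn; apply: is_ideal_sum => // i _.
rewrite -mulr_natl; have [_ _ IM] := Iid; apply: (IM).
have [mi|im] := leqP m i; first by apply: (IM); apply: expr_in_ideal mi.
rewrite mulrC; apply: (IM); apply: (expr_in_ideal _ In) => //.
by rewrite -addnBA ?leq_addr // ltnW.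
Qed.

Hypothesis locD : is_ideal nonunits.

Let M0 : nonunits 0. Proof. by case: locD. Qed.
Let M1 : ~ nonunits 1. Proof. by rewrite /nonunits /= unitr1. Qed.

Lemma local_1B m : nonunits m -> 1 - m \is a GRing.unit.
Proof.
move=> Mm; apply/negPn/negP => M1m; apply: M1; rewrite -(subrK m 1).
by case: locD => _ MD _; apply: MD.
Qed.

(** Nakayama's lemma.  Induction on the generators: enlarging [N] by the first
    generator [x] absorbs it, so the others lie in [N + xD]; then
    [x] is in [N + xM] for the maximal ideal [M], hence in [N]. *)
Lemma nakayama (s : seq D) N : is_ideal N ->
  (forall a, a \in s ->
     isum N (imul nonunits (ideal_gen [set` s])) a) ->
  forall a, a \in s -> N a.
Proof.
elim: s N => // x s IHs N Nid HN.
have [N0 ND NM] := Nid.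
pose N' := isum N (scale_set x setT).
have N'id : is_ideal N' by apply: isum_ideal => //; apply: principal_ideal.
have gsub : ideal_gen [set` x :: s] `<=`
            isum (scale_set x setT) (ideal_gen [set` s]).
  have gid := ideal_gen_ideal [set` s]; have xid := principal_ideal x.
  apply: ideal_gen_sub; first exact: isum_ideal.
  move=> y; rewrite /= inE => /orP[/eqP->|ys].
    by apply: isum_l => //; exists 1; rewrite ?mulr1.
  by apply: isum_r => //; apply: sub_ideal_gen.
have sN' : forall a, a \in s -> N' a.
  apply: IHs => // a sa.
  have /HN[n [w [Nn Mw ->]]] : a \in x :: s by rewrite inE sa orbT.
  have [U0 UD UM] : is_ideal
      (isum (scale_set x setT) (imul nonunits (ideal_gen [set` s]))).
    by apply: isum_ideal; [exact: principal_ideal|exact: imul_ideal].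
  have /(_ w Mw)[_ [v [[r _ <-] Mv ->]]] :
      imul nonunits (ideal_gen [set` x :: s]) `<=`
      isum (scale_set x setT) (imul nonunits (ideal_gen [set` s])).
    apply: imul_sub => // m y Mm /gsub[_ [v [[r _ <-] Mv ->]]].
    exists (x * (m * r)), (m * v); split; [by exists (m * r)| |by ring].
    exact: mem_imul.
  exists (n + x * r), v; split=> //; last by ring.
  by exists n, (x * r); split=> //; exists r.
have gN' : ideal_gen [set` x :: s] `<=` N'.
  apply: ideal_gen_sub => // y; rewrite /= inE => /orP[/eqP->|/sN' //].
  by apply: isum_r => //; exists 1; rewrite ?mulr1.
have Nx : N x.
  have /HN[n [w [Nn Mw xE]]] : x \in x :: s by rewrite inE eqxx.
  have Uid : is_ideal (isum N (scale_set x nonunits)).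
    apply: isum_ideal => //; have [_ MD MM] := locD.
    split=> [|_ _ [a Ma <-] [b Mb <-]|c _ [b Mb <-]].
    - by exists 0; rewrite ?mulr0.
    - by exists (a + b); rewrite ?mulrDr //; apply: MD.
    - by exists (c * b); [apply: MM|rewrite mulrCA].
  have /(_ w Mw)[n' [_ [Nn' [m Mm <-] wE]]] :
      imul nonunits (ideal_gen [set` x :: s]) `<=`
      isum N (scale_set x nonunits).
    apply: imul_sub => // m y Mm /gN'[n1 [_ [Nn1 [r _ <-] ->]]].
    exists (m * n1), (x * (r * m)); split; [exact: NM| |by ring].
    by exists (r * m) => //; apply: nonunitsM.
  suff -> : x = (1 - m)^-1 * (n + n') by apply: NM; apply: ND.
  apply: (mulrI (local_1B Mm)); rewrite mulVKr ?local_1B //.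
  by rewrite mulrBl mul1r {1}xE wE; ring.
move=> a; rewrite inE => /orP[/eqP-> //|/sN'[n [_ [Nn [r _ <-] ->]]]].
by apply: ND => //; rewrite mulrC; apply: NM.
Qed.

(** A radical factor of [I] contains [I], hence every nonunit, so it is the
    maximal ideal or the whole ring. *)
Lemma radprod_ipow I : radprod (@ideal_gen D) I ->
  (forall x, nonunits x -> exists n, I (x ^+ n)) ->
  exists k, I = ipow nonunits k.
Proof.
elim=> {I} [|J I Jid rJ rI IH] nil; first by exists 0%N; rewrite ideal_gen1.
have {}Jid : is_ideal J by rewrite -Jid; apply: ideal_gen_ideal.
have Iid := radprod_ideal rI.
have [x Mx|k IE] := IH.
  by have [n Hn] := nil x Mx; exists n; apply: imul_subr Hn.
have MJ : nonunits `<=` J.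
  move=> x Mx; have [n Hn] := nil x Mx; apply: (radicalP (n := n) rJ).
  by apply: expr_in_ideal (leqnSn n) => //; apply: imul_subl Hn.
have [JT|JM] := proper_sub_nonunits Jid.
  by exists k; rewrite -/(imul J I) JT imul1I.
exists k.+1; rewrite /= -IE (_ : J = nonunits) //.
by apply/seteqP; split.
Qed.

(** With [M] the maximal ideal and [A] the ideal generated by [s], [A = M^k]
    for some k > 0, and [M] differs from [M^2], as otherwise [A = M A].
    For [z] in [M] outside [M^2], [zD + M^2] is a power of [M] as well, and can
    only be [M].  Hence [M^k = z^k D + M A], so [A] is generated by [z^k]; as
    [y z^(k-1)] is in [A] for [y] in [M], [z] divides [y]. *)
Lemma fg_primary_principal (s : seq D) : SP_domain D ->
  ideal_gen [set` s] `<=` nonunits ->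
  (exists2 a, ideal_gen [set` s] a & a != 0) ->
  (forall x, nonunits x -> exists n, ideal_gen [set` s] (x ^+ n)) ->
  exists z, nonunits = scale_set z setT.
Proof.
move=> /SP_domainP spD; set A := ideal_gen _ => AM [a Aa a0] nilA.
have Aid : is_ideal A by apply: ideal_gen_ideal.
have nak N : is_ideal N -> A `<=` isum N (imul nonunits A) -> A `<=` N.
  move=> Nid AN; apply: ideal_gen_sub => //; apply: nakayama => // b sb.
  by apply: AN; apply: sub_ideal_gen.
have [[|k] AE] := radprod_ipow (spD A Aid) nilA.
  by case: M1; apply: AM; rewrite AE.
have [z Mz nz] : exists2 z, nonunits z & ~ imul nonunits nonunits z.
  apply: contrapT => nex.
  have MMM : nonunits `<=` imul nonunits nonunits.
    by move=> z Mz; apply: contrapT => nz; apply: nex; exists z.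
  have A0 : A `<=` scale_set 0 setT.
    apply: nak; first exact: principal_ideal.
    apply: subset_trans (isum_r (principal_ideal 0)).
    rewrite {1}AE AE /=.
    apply: subset_trans (@imulA_sub _ _ _).
    exact: imulS.
  by have [r _] := A0 a Aa; rewrite mul0r => a0'; rewrite -a0' eqxx in a0.
have zid := principal_ideal z.
have Mgen : nonunits `<=` isum (scale_set z setT) (imul nonunits nonunits).
  set I := isum _ _.
  have Iid : is_ideal I by apply: isum_ideal => //; apply: imul_ideal.
  have Iz : I z by apply: isum_l (imul_ideal _ _) _ _; exists 1; rewrite ?mulr1.
  (* The exponent m is neither 0, as 1 is not in I, nor at least 2, as z is. *)
  have [x Mx|m IE] := radprod_ipow (spD I Iid).
    exists 2%N; apply: isum_r => //; rewrite expr2; exact: mem_imul.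
  case: m => [|[|m]] in IE *.
  - case: M1; have : I 1 by rewrite IE.
    case=> _ [w [[r _ <-] Mw ->]]; have [_ MD MM] := locD.
    by apply: MD; [rewrite mulrC; apply: MM|apply: imul_subl Mw].
  - by rewrite IE /= imulI1.
  - case: nz; move: Iz; rewrite IE /=; apply: imulS => // x.
    exact: imul_subl.
have step j : ipow nonunits j `<=`
    isum (scale_set (z ^+ j) setT) (ipow nonunits j.+1).
  elim: j => [|j IHj].
    move=> x _; exists x, 0; rewrite addr0; split=> //.
      by exists x; rewrite // mul1r.
    by case: (ipow_ideal nonunits 1).
  have Uid : is_ideal
      (isum (scale_set (z ^+ j.+1) setT) (ipow nonunits j.+2)).
    by apply: isum_ideal; [exact: principal_ideal|exact: ipow_ideal].
  apply: imul_sub => // x y Mx /IHj[_ [w [[r _ <-] Mw ->]]].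
  have /Mgen[_ [v [[t _ <-] Mv xE]]] := Mx.
  exists (z ^+ j.+1 * (t * r)), (r * (v * z ^+ j) + x * w).
  split; [by exists (t * r)| |by rewrite mulrDr {1}xE exprS; ring].
  have [_ PD PM] := ipow_ideal nonunits j.+2.
  apply: (PD); last exact: mem_imul.
  apply: (PM); apply: imulA_sub; apply: mem_imul => //; exact: mem_ipow.
have Az : A `<=` scale_set (z ^+ k.+1) setT.
  apply: nak; first exact: principal_ideal.
  by have := step k.+1; rewrite -AE /= -/(ipow nonunits k.+1) -AE.
have z0 : z != 0.
  apply/eqP => z0; have [r _] := Az a Aa.
  by rewrite z0 expr0n mul0r => a0'; rewrite -a0' eqxx in a0.
exists z; apply/seteqP; split=> [y My|_ [r _ <-]]; last first.
  by rewrite mulrC; apply: nonunitsM.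
have /Az[r _ yE] : A (y * z ^+ k) 
  by rewrite AE /=; apply: mem_imul => //; apply: mem_ipow.
exists r => //; apply: (mulIf (expf_neq0 k z0)).
by rewrite -yE exprSr; ring.
Qed.

End LocalDomain.

(** * Local SP-domains are discrete valuation domains *)

Lemma imul_fg (D : idomainType) (I : set D) x : imul I I x ->
  exists s : seq D, (forall a, a \in s -> I a) /\
    imul (ideal_gen [set` s]) (ideal_gen [set` s]) x.
Proof.
pose G s := ideal_gen [set` (s : seq D)].
have GS s t : {subset s <= t} -> imul (G s) (G s) `<=` imul (G t) (G t).
  move=> st; have Gst : G s `<=` G t.
    apply: ideal_gen_sub; first exact: ideal_gen_ideal.
    by move=> y /st yt; apply: sub_ideal_gen.
  exact: imulS.
apply: (imul_sub (A := [set x | exists s : seq D,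
  (forall a, a \in s -> I a) /\ imul (G s) (G s) x])).
  split=> [|a b [s [sI sa]] [t [tI tb]]|c a [s [sI sa]]] /=.
  - by exists [::]; split=> //; case: (imul_ideal (G [::]) (G [::])).
  - exists (s ++ t); split.
      by move=> y; rewrite mem_cat => /orP[/sI|/tI].
    have [_ PD _] := imul_ideal (G (s ++ t)) (G (s ++ t)).
    by apply: PD; [apply: GS sa|apply: GS tb] => y ys;
      rewrite mem_cat ys ?orbT.
  - by exists s; split=> //; have [_ _ PM] := imul_ideal (G s) (G s); apply: PM.
move=> a b Ia Ib; exists [:: a; b]; split.
  by move=> y; rewrite !inE => /orP[] /eqP->.
by apply: mem_imul; apply: sub_ideal_gen; rewrite /= !inE eqxx ?orbT.
Qed.

(** By Zorn's lemma.  The complement of a maximal such [S] is a minimal prime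
    over [J]; the second property says that in [S^-1 D] every nonunit
    is nilpotent modulo the extension of [J]. *)
Lemma maximal_mulset (D : idomainType) (J : set D) : is_ideal J -> ~ J 1 ->
  exists S : mulset D, (forall s, S s -> ~ J s) /\
    (forall z, ~ S z -> exists s n, S s /\ J (s * z ^+ n)).
Proof.
move=> Jid J1; have [J0 _ _] := Jid.
pose mc (Y : set D) := forall s t, Y s -> Y t -> Y (s * t).
pose P : set (set D) := [set Y | mc Y /\ forall s, Y s -> ~ J s].
have chain F : F `<=` P -> total_on F subset -> P (\bigcup_(X in F) X).
  move=> FP Ftot; split=> [s t [X FX Xs] [Y FY Yt]|s [X FX Xs]]; last first.
    by have [_] := FP X FX; apply.
  have [XY|YX] := Ftot X Y FX FY.
    by exists Y => //; have [mcY _] := FP Y FY; apply: mcY => //; apply: XY.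
  by exists X => //; have [mcX _] := FP X FX; apply: mcX => //; apply: YX.
have [A [[mcA AJ] maxA]] := Zorn_bigcup chain.
(* Members of P need not contain 1, so that the empty union is in P. *)
have A1 : A 1.
  apply: contrapT => nA1; apply: (maxA (A `|` [set 1])).
    by split=> [x Ax|AA]; [left|apply: nA1; apply: AA; right].
  split=> [s t [As|->] [At|->]|s [/AJ //|-> //]]; rewrite ?mulr1 ?mul1r.
  - by left; apply: mcA.
  - by left.
  - by left.
  - by right.
have A0 s : A s -> s != 0.
  by move=> As; apply/eqP => s0; apply: (AJ s); rewrite // s0.
exists (MulSet A1 mcA A0); split=> //= z Az.
apply: contrapT => nz.
apply: (maxA [set x | exists s n, A s /\ x = s * z ^+ n]).
  split=> [x Ax|AA]; first by exists x, 0%N; rewrite mulr1.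
  by apply: Az; apply: AA; exists 1, 1%N; rewrite mul1r expr1.
split=> [_ _ [s [n [As ->]]] [t [m [At ->]]]|_ [s [n [As ->]]] Jsz].
  exists (s * t), (n + m)%N; split; first exact: mcA.
  by rewrite exprD; ring.
by apply: nz; exists s, n.
Qed.

(** If [x] is in [N^2] then it is in [J^2] for a finitely generated [J] inside
    [N].  Localized at a minimal prime over [J], the domain has a principal
    maximal ideal [z], and [J] lies in it; so [z ^+ 2] divides [x] there, while
    [x] still generates a radical ideal. *)
Lemma radical_notin_square (D : idomainType) (N : set D) x : SP_domain D ->
  is_ideal N -> ~ N 1 -> radical (scale_set x setT) -> x != 0 ->
  ~ imul N N x.
Proof.
move=> spD Nid N1 rx x0 /imul_fg[s [sN]]; set J := ideal_gen _ => Jx.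
have Jid : is_ideal J by apply: ideal_gen_ideal.
have JN : J `<=` N by apply: ideal_gen_sub.
have J1 : ~ J 1 by move/JN.
have [S [SJ Smax]] := maximal_mulset Jid J1.
pose phi : {rmorphism D -> localization S} := loc_in S.
have phiP : localizing phi := loc_in_localizing S.
have [phi_inj _] := phiP.
have phiU t : S t -> phi t \is a GRing.unit by apply: loc_in_unit.
have Eid := ext_ideal phiP Jid.
have nonJ b y : J b -> phi b * y <> 1.
  move=> Jb bE; have [t [c [St tc]]] := loc_inP y.
  apply: (SJ t St); suff <-: b * c = t.
    by rewrite mulrC; case: Jid => _ _; apply.
  apply: phi_inj; rewrite rmorphM [phi c](esym tc).
  by rewrite mulrCA bE mulr1.
have nilE y : nonunits y -> exists n, ext phi J (y ^+ n).
  move=> My; have [t [a [St ta]]] := loc_inP y.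
  have /Smax[t' [n [St' Jta]]] : ~ S a.
    move=> /phiU; rewrite [phi a](esym ta) unitrM => /andP[_ yu].
    by move: My; rewrite /nonunits /= yu.
  exists n, (t' * t ^+ n), (t' * a ^+ n); split=> //.
    by rewrite rmorphM rmorphXn unitrM unitrX ?phiU.
  by rewrite !(rmorphM, rmorphXn) [phi a](esym ta) exprMn mulrA.
have Enil y n : ext phi J (y ^+ n) -> nonunits y.
  move=> [t [b [tu Jb tb]]]; apply/negP => yu.
  apply: (nonJ b (phi b)^-1) => //; apply: mulrV.
  by rewrite -tb unitrM tu unitrX.
have locE : is_ideal (@nonunits (localization S)).
  split; first by rewrite /nonunits /= unitr0.
    move=> y z /nilE[n yn] /nilE[m zm].
    by apply: (@Enil _ (n + m)%N); apply: nilpotent_mod_add.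
  by move=> a y; apply: nonunitsM.
pose t := [seq phi a | a <- s].
have gt a : J a -> ideal_gen [set` t] (phi a).
  move: a; apply: ideal_gen_sub.
    exact/contraction_ideal/ideal_gen_ideal.
  by move=> a sa; apply: sub_ideal_gen; apply: map_f.
have [z Mz] : exists z, @nonunits (localization S) = scale_set z setT.
  apply: (@fg_primary_principal _ locE t (SP_localizing phiP spD)).
  - apply: ideal_gen_sub => // _ /mapP[a sa ->].
    apply: (@Enil _ 1%N); rewrite expr1; apply: ext_mem.
    exact: sub_ideal_gen.
  - exists (phi x); last by rewrite -(rmorph0 phi) (inj_eq phi_inj).
    by apply: gt; apply: imul_subl Jx.
  - move=> y /nilE[n En]; exists n; apply: ext_sub En => //.
    exact: ideal_gen_ideal.
have [w phix] : exists w, phi x = z ^+ 2 * w.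
  have zzid := principal_ideal (z ^+ 2).
  have /(_ x Jx)[w _ <-] :
      imul J J `<=` phi @^-1` (scale_set (z ^+ 2) setT); last by exists w.
  have JM a : J a -> exists r, phi a = z * r.
    move=> Ja; have : nonunits (phi a).
      by apply: (@Enil _ 1%N); rewrite expr1; apply: ext_mem.
    by rewrite Mz => -[r _ <-]; exists r.
  apply: imul_sub; first exact: contraction_ideal.
  move=> a b /JM[r ar] /JM[r' br]; exists (r * r') => //.
  by rewrite rmorphM ar br; ring.
have : z \is a GRing.unit.
  apply: radical_squarefree phix; last first.
    by rewrite -(rmorph0 phi) (inj_eq phi_inj).
  have := ext_radical phiP (principal_ideal x) rx.
  congr radical; apply/seteqP; split.
    apply: ext_sub; first exact: principal_ideal.
    by move=> _ [r _ <-]; exists (phi r); rewrite // rmorphM.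
  move=> _ [y _ <-]; have [_ _ EM] := ext_ideal phiP (principal_ideal x).
  by rewrite mulrC; apply: EM; apply: ext_mem; exists 1; rewrite ?mulr1.
move=> zu; have : nonunits z by rewrite Mz; exists 1; rewrite ?mulr1.
by rewrite /nonunits /= zu.
Qed.

Section LocalSP.
Variable D : idomainType.
Hypothesis locD : is_ideal (@nonunits D).
Hypothesis spD : SP_domain D.
Implicit Types (I J : set D) (c x y z : D).

(** If all products of elements of [J] and [I] were nonunit multiples of [c],
    [c] itself would be one; so [c] is a product [j * i], and then [j]
    generates [J], because [x * i] is a multiple of [j * i] for [x] in [J]. *)
Lemma principal_factors I J c : is_ideal I -> is_ideal J -> c != 0 ->
  imul J I = scale_set c setT ->
  exists j i, [/\ J = scale_set j setT, I = scale_set i setT & c = j * i].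
Proof.
move=> Iid Jid c0 JIc.
have [j [i [u [Jj Ii uu jiE]]]] : exists j i u,
    [/\ J j, I i, u \is a GRing.unit & j * i = c * u].
  apply: contrapT => nex.
  have cMid : is_ideal (scale_set c (@nonunits D)).
    have [_ MD MM] := locD.
    split=> [|_ _ [a Ma <-] [b Mb <-]|a _ [b Mb <-]].
    - by exists 0; rewrite ?mulr0 // /nonunits /= unitr0.
    - by exists (a + b); rewrite ?mulrDr //; apply: MD.
    - by exists (a * b); [apply: MM|rewrite mulrCA].
  have /(_ c)[|m Mm] : imul J I `<=` scale_set c (@nonunits D).
  - apply: imul_sub => // j i Jj Ii.
    have : imul J I (j * i) by apply: mem_imul.
    rewrite JIc => -[r _ rE]; exists r => //; apply/negP => ru.
    by apply: nex; exists j, i, r.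
  - by rewrite JIc; exists 1; rewrite ?mulr1.
  - rewrite -{2}[c]mulr1 => /(mulfI c0) m1; move: Mm.
    by rewrite m1 /nonunits /= unitr1.
have cE : c = j / u * i by apply: (mulIr uu); rewrite -jiE mulrAC divrK.
have Jju : J (j / u) by rewrite mulrC; case: Jid => _ _; apply.
have ji0 : (j / u) * i != 0 by rewrite -cE.
have [ju0 i0] : j / u != 0 /\ i != 0.
  by move: ji0; rewrite mulf_eq0 negb_or => /andP.
exists (j / u), i; split=> //; apply/seteqP; split.
- move=> x Jx; have : imul J I (x * i) by apply: mem_imul.
  rewrite JIc cE => -[r _ rE]; exists r => //; apply: (mulIf i0).
  by rewrite -rE; ring.
- by move=> _ [r _ <-]; rewrite mulrC; case: Jid => _ _; apply.
- move=> x Ix; have : imul J I (j / u * x) by apply: mem_imul.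
  rewrite JIc cE => -[r _ rE]; exists r => //; apply: (mulfI ju0).
  by rewrite -rE; ring.
- by move=> _ [r _ <-]; rewrite mulrC; case: Iid => _ _; apply.
Qed.

Lemma radprod_principal c : radprod (@ideal_gen D) (scale_set c setT).
Proof. by have /SP_domainP := spD; apply; exact: principal_ideal. Qed.

(** By [principal_factors] the radical factors of [cD] are principal, and one of
    them is proper. *)
Lemma ex_radical_element c : c != 0 -> nonunits c ->
  exists x, [/\ x != 0, nonunits x & radical (scale_set x setT)].
Proof.
have [I IE] : exists I, I = scale_set c setT by exists (scale_set c setT).
move: (radprod_principal c); rewrite -IE => rI.
elim: rI c IE => {I} [|J I Jid rJ rI IH] c IE c0 Mc.
  have : scale_set c setT 1 by rewrite -IE ideal_gen1.
  case=> r _ cr; move: Mc; rewrite /nonunits /= => /negP[].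
  by apply/unitrPr; exists r.
have Jd : is_ideal J by rewrite -Jid; apply: ideal_gen_ideal.
have [j [i [JE IE' cE]]] := principal_factors (radprod_ideal rI) Jd c0 IE.
move: c0; rewrite cE mulf_eq0 negb_or => /andP[j0 i0].
have [ju|jM] := boolP (j \is a GRing.unit); last by exists j; rewrite -JE.
apply: (IH i) => //; apply/negP => iu.
by move: Mc; rewrite /nonunits /= cE unitrM ju iu.
Qed.

(** By [radical_notin_square], a factorization of [I] has at most one proper
    factor. *)
Lemma radical_ideal_of_element x I : radical (scale_set x setT) -> x != 0 ->
  radprod (@ideal_gen D) I -> I x -> I = setT \/ radical I.
Proof.
move=> rx x0; elim=> {I} [|J I Jid rJ rI IH] Ix.
  by left; rewrite ideal_gen1.
have Jd : is_ideal J by rewrite -Jid; apply: ideal_gen_ideal.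
have Id := radprod_ideal rI.
move: Ix; rewrite -/(imul J I) => Ix.
have [JT|JM] := proper_sub_nonunits Jd.
  by rewrite JT imul1I //; apply: IH; apply: imul_subr Ix.
have [IT|IM] := proper_sub_nonunits Id; first by right; rewrite IT imulI1.
have M1 : ~ @nonunits D 1 by rewrite /nonunits /= unitr1.
by case: (radical_notin_square spD locD M1 rx x0); apply: imulS Ix.
Qed.

(** A radical element [x] divides each nonunit [y], since the radical ideal
    [(x, y^2)] contains [y].  A radical factor of [cD] is then generated by
    a unit or by [x] times a unit, because it is not divisible by [x ^+ 2]. *)
Lemma SP_local_uniformizer : ~ is_field D ->
  exists z, @nonunits D z /\
    forall c, c != 0 -> exists n u, u \is a GRing.unit /\ c = u * z ^+ n.
Proof.
move=> nfD; have [M0 MD MM] := locD.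
have [c c0 Mc] : exists2 c : D, c != 0 & nonunits c.
  apply: contrapT => nex; apply: nfD => x x0; apply/negPn/negP => Mx.
  by apply: nex; exists x.
have {c c0 Mc} [x [x0 Mx rx]] := ex_radical_element c0 Mc.
have Mgen y : nonunits y -> exists r, y = x * r.
  move=> My; pose I := isum (scale_set x setT) (scale_set (y ^+ 2) setT).
  have yyid := principal_ideal (y ^+ 2); have xid := principal_ideal x.
  have Iid : is_ideal I by apply: isum_ideal.
  have Ix : I x by apply: isum_l => //; exists 1; rewrite ?mulr1.
  have rI : radprod (@ideal_gen D) I by have /SP_domainP := spD; apply.
  have [IT|radI] := radical_ideal_of_element rx x0 rI Ix.
    have : I 1 by rewrite IT.
    case=> _ [_ [[r _ <-] [t _ <-] e]].
    have : @nonunits D 1.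
      rewrite e; apply: (MD); rewrite mulrC; apply: (MM) => //.
      by rewrite expr2; apply: (MM).
    by rewrite /nonunits /= unitr1.
  have : I y.
    apply: (radicalP (n := 1%N) radI); apply: isum_r => //.
    by exists 1; rewrite ?mulr1.
  case=> _ [_ [[r _ <-] [t _ <-] e]].
  have yu : 1 - y * t \is a GRing.unit.
    by apply: local_1B => //; rewrite mulrC; apply: MM.
  exists (r / (1 - y * t)); apply: (mulIr yu); rewrite mulrA divrK //.
  by rewrite mulrBr mulr1 {1}e; ring.
exists x; split=> // c.
have [I IE] : exists I, I = scale_set c setT by exists (scale_set c setT).
move: (radprod_principal c); rewrite -IE => rI.
elim: rI c IE => {I} [|J I Jid rJ rI IH] c IE c0.
  have : scale_set c setT 1 by rewrite -IE ideal_gen1.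
  case=> r _ cr; exists 0%N, c; rewrite mulr1; split=> //.
  by apply/unitrPr; exists r.
have Jd : is_ideal J by rewrite -Jid; apply: ideal_gen_ideal.
have [j [i [JE IE' cE]]] := principal_factors (radprod_ideal rI) Jd c0 IE.
move: c0; rewrite cE mulf_eq0 negb_or => /andP[j0 i0].
have [n [u [uu iE]]] := IH i IE' i0.
have [ju|/Mgen[w jE]] := boolP (j \is a GRing.unit).
  by exists n, (j * u); rewrite unitrM ju uu iE mulrA.
have [wu|/Mgen[w' wE]] := boolP (w \is a GRing.unit).
  by exists n.+1, (w * u); rewrite unitrM wu uu iE jE exprS; split=> //; ring.
have : x \is a GRing.unit.
  rewrite JE in rJ; apply: (radical_squarefree (w := w') rJ j0).
  by rewrite jE wE; ring.
by move=> xu; move: Mx; rewrite /nonunits /= xu.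
Qed.

End LocalSP.

(** * Ideals of the Nagata ring *)

Section Nagata.
Variables (R : idomainType) (star : star_operation R).
Implicit Types (I J M : set R) (f g : {poly R}).

(** The ideal I[X] of R[X]. *)
Definition polyset I : set {poly R} := [set f | forall i, I f`_i].

Lemma polyset_ideal I : is_ideal I -> is_ideal (polyset I).
Proof.
move=> Iid; have [I0 ID IM] := Iid.
split=> [i|f g If Ig i|f g Ig i]; first by rewrite coef0.
  by rewrite coefD; apply: ID.
by rewrite coefM; apply: is_ideal_sum => // k _; apply: IM.
Qed.

Lemma polyset_imul I J f g : polyset I f -> polyset J g ->
  polyset (imul I J) (f * g).
Proof.
move=> If Jg i; rewrite coefM; apply: is_ideal_sum; first exact: imul_ideal.
by move=> k _; apply: mem_imul.
Qed.

Lemma notin_polyset M f : ~ polyset M f -> exists i, ~ M f`_i.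
Proof. by move=> /existsNP. Qed.

Lemma notin_polysetM M f g : star_max star M -> ~ polyset M f ->
  ~ polyset M g -> ~ polyset M (f * g).
Proof.
move=> Mmax /notin_polyset fM /notin_polyset gM fgM.
by have [k] := star_max_content Mmax fM gM; apply.
Qed.

Lemma N_star_notin_polyset M g : star_max star M -> N_star star g ->
  ~ polyset M g.
Proof.
move=> [Mst MT _] Ng gM; apply: MT; apply/seteqP; split=> // x _.
rewrite -Mst; have : star (content g) x by rewrite Ng.
by apply: star_mono; apply: content_sub gM; apply: star_ideal_is_ideal Mst.
Qed.

(** [N_star] is the complement of the union of the ideals M[X]; in particular it
    is saturated. *)
Lemma N_starP g :
  N_star star g <-> forall M, star_max star M -> ~ polyset M g.
Proof.
split=> [Ng M Mmax|H]; first exact: N_star_notin_polyset.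
apply: is_ideal1; first exact: star_is_ideal.
apply: contrapT => /star_max_exists[M Mmax gM].
by apply: (H M Mmax) => i; apply: gM; apply: content_coef.
Qed.

(** No [M] contains the coefficients of all members of [B], so finitely many of
    them generate [R] up to [star].  Shifting the polynomials that they come from, so
    that no two terms overlap, gives one member of [B] with all these
    coefficients. *)
Lemma ideal_meets_N_star (B : set {poly R}) : is_ideal B ->
  (forall M, star_max star M -> exists2 f, B f & ~ polyset M f) ->
  exists2 g, B g & N_star star g.
Proof.
move=> [B0 BD BM] HB.
pose C : set R := [set c | exists2 f, B f & exists i, c = f`_i].
have : star C 1.
  apply: contrapT => /star_max_exists[M Mmax CM].
  have [f Bf] := HB M Mmax; apply=> i; apply: CM.
  by exists f => //; exists i.
rewrite star_finite_type => -[E [EC finE]] E1.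
have /finite_seqP[s Es] := finE; rewrite {finE}Es in EC E1.
have [g Bg sg] : exists2 g, B g & forall c, c \in s -> exists i, c = g`_i.
  elim: s EC {E1} => [|c s IHs] sC; first by exists 0.
  have [c' sc'|g Bg sg] := IHs.
    by apply: sC; rewrite /= inE [_ \in _]sc' orbT.
  have [f Bf [i ci]] : C c by apply: sC; rewrite /= inE eqxx.
  exists (g * 'X^(size f) + f).
    by apply: BD => //; rewrite mulrC; apply: BM.
  move=> c'; rewrite inE => /orP[/eqP->|/sg[k ->]].
    have [fi|fi] := ltnP i (size f).
      by exists i; rewrite coefD coefMXn fi add0r.
    exists (size g + size f)%N; rewrite ci coefD coefMXn.
    rewrite (nth_default 0 fi) ifN; last by rewrite -leqNgt leq_addl.
    by rewrite addnK !nth_default ?addr0 // leq_addl.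
  exists (k + size f)%N; rewrite coefD coefMXn ifN.
    by rewrite addnK (nth_default 0 (leq_addl _ _)) addr0.
  by rewrite -leqNgt leq_addl.
exists g => //; apply: is_ideal1; first exact: star_is_ideal.
by move: E1; apply: star_mono => c /sg[i ->]; apply: content_coef.
Qed.

Let iota : {rmorphism {poly R} -> Na star} := loc_in (Nagata_mulset star).
Let jR : {rmorphism R -> Na star} := iota \o polyC.

Lemma Na_unit_N_star f : iota f \is a GRing.unit -> N_star star f.
Proof.
move=> fu; have [g [h [Ng gh]]] := loc_inP (iota f)^-1.
have fh : f * h = g.
  apply: (@loc_in_inj _ (Nagata_mulset star)); rewrite -/iota.
  have gh' : iota g * (iota f)^-1 = iota h := gh.
  by rewrite rmorphM -gh' mulrCA mulrV ?mulr1.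
apply/N_starP => M Mmax fM; apply: (N_star_notin_polyset Mmax Ng).
rewrite -fh mulrC.
have [Mst _ _] := Mmax.
by have [_ _] := polyset_ideal (star_ideal_is_ideal Mst); apply.
Qed.

Lemma iota_localizing : localizing iota.
Proof. exact: loc_in_localizing. Qed.

(** The denominators that bring [x] into [U] form an ideal of R[X]; if it lies
    in no M[X], it contains an invertible denominator. *)
Lemma Na_local_mem (U : set (Na star)) x : is_ideal U ->
  (forall M, star_max star M ->
     exists2 f, U (iota f * x) & ~ polyset M f) -> U x.
Proof.
move=> Uid HU; have [U0 UD UM] := Uid.
have Bid : is_ideal [set f | U (iota f * x)].
  split=> [|f g Uf Ug|f g Ug] /=; first by rewrite rmorph0 mul0r.
    by rewrite rmorphD mulrDl; apply: UD.
  by rewrite rmorphM -mulrA; apply: UM.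
have [g /= Ug Ng] := ideal_meets_N_star Bid HU.
have gu : iota g \is a GRing.unit by apply: loc_in_unit.
by rewrite -[x](mulKr gu); apply: UM.
Qed.

Lemma iota_coefs (U : set (Na star)) f : is_ideal U ->
  (forall i, U (jR f`_i)) -> U (iota f).
Proof.
move=> Uid Uf; rewrite -[f]coefK poly_def rmorph_sum.
apply: is_ideal_sum => // i _; rewrite -mul_polyC rmorphM mulrC.
by case: Uid => _ _; apply; apply: Uf.
Qed.

Lemma polyset_polyC I c : is_ideal I -> I c -> polyset I c%:P.
Proof. by move=> [I0 _ _] Ic i; rewrite coefC; case: ifP. Qed.

(** If [g * r] has its coefficients in [I] with [g] in [N_star], then
    [r] is in [r * star (content g)], which equals [star (r * content g)]. *)
Lemma ext_polyset_contraction I r : is_ideal I ->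
  ext iota (polyset I) (jR r) -> star I r.
Proof.
move=> Iid [g [f [/Na_unit_N_star Ng If gr]]].
have /iota_localizing.1 fE : iota (g * r%:P) = iota f by rewrite rmorphM -gr.
have gI : content g `<=` [set c | I (c * r)].
  apply: content_sub => [|i]; first exact: colon_ideal.
  by rewrite /= -coefMC fE; apply: If.
have : scale_set r (star (content g)) r by rewrite Ng; exists 1; rewrite ?mulr1.
rewrite star_scale; apply: star_mono => _ [c /gI Ic <-].
by rewrite mulrC.
Qed.

Lemma ext_polysetP I r : star_ideal star I ->
  ext iota (polyset I) (jR r) <-> I r.
Proof.
move=> Ist; have Iid := star_ideal_is_ideal Ist; split=> [Ir|Ir].
  by rewrite -Ist; apply: ext_polyset_contraction.
by apply: ext_mem; apply: polyset_polyC.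
Qed.

(** Every localization at a maximal star ideal is a valuation domain, with
    denominators cleared. *)
Definition locally_valuation : Prop :=
  forall M, star_max star M -> forall a b,
    exists2 s, ~ M s & (exists r, s * b = a * r) \/ (exists r, s * a = b * r).

Hypothesis valR : locally_valuation.

(** In a valuation domain one of the finitely many generators divides all the
    others. *)
Lemma locally_principal M x0 (e : seq R) : star_max star M ->
  exists a s, [/\ a \in x0 :: e, ~ M s &
                  forall b, b \in x0 :: e -> exists r, s * b = a * r].
Proof.
move=> Mmax; elim: e => [|y e [a [s [ae Ms sa]]]].
  exists x0, 1; rewrite inE eqxx; split=> //; first exact: star_max_not1 Mmax.
  by move=> b; rewrite inE => /eqP->; exists 1; rewrite mul1r mulr1.
have [s' Ms' [[r' ya]|[r' ay]]] := valR Mmax a y.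
- exists a, (s * s'); split.
  + by move: ae; rewrite !inE => /orP[->|->]; rewrite ?orbT.
  + exact: (star_max_notM Mmax).
  + move=> b; rewrite !inE orbCA => /orP[/eqP->|be].
      by exists (s * r'); rewrite -mulrA ya; ring.
    have [r br] := sa b be; exists (s' * r).
    by rewrite [s * s']mulrC -mulrA br; ring.
- exists y, (s * s'); split.
  + by rewrite !inE eqxx orbT.
  + exact: (star_max_notM Mmax).
  + move=> b; rewrite !inE orbCA => /orP[/eqP->|be].
      by exists (s * s'); rewrite mulrC.
    have [r br] := sa b be; exists (r' * r).
    by rewrite [s * s']mulrC -mulrA br mulrA ay; ring.
Qed.

(** [x] is in [star E] for some finite [E] inside [I]; locally [E] generates the
    principal ideal of some [a] in [E], and principal ideals are closed. *)
Lemma star_locally I x M : is_ideal I -> star I x -> star_max star M ->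
  exists2 s, ~ M s & I (s * x).
Proof.
move=> Iid + Mmax; rewrite star_finite_type => -[E [EI finE]] Ex.
have /finite_seqP[e Ee] := finE; rewrite {finE}Ee in EI Ex.
have [I0 _ IM] := Iid.
(* The extra generator 0 covers the case where e is empty. *)
have [a [s [ae Ms sa]]] := locally_principal 0 e Mmax.
exists s => //; have Ia : I a.
  by move: ae; rewrite inE => /orP[/eqP->|/EI].
have starT : star setT = setT.
  by apply/seteqP; split=> // y _; apply: sub_star.
have : star (scale_set s [set` e]) (s * x).
  by rewrite -star_scale; exists x.
have /star_mono h : scale_set s [set` e] `<=` scale_set a setT.
  move=> _ [b be <-]; have [|r ->] := sa b; last by exists r.
  by rewrite inE [_ \in e]be orbT.
move=> /(h star); rewrite -star_scale starT => -[r _ <-].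
by rewrite mulrC; apply: IM.
Qed.

(** By [star_locally], [star] adds only elements that are locally in the
    contraction, and membership in [U] is local. *)
Lemma contraction_star_ideal (U : set (Na star)) : is_ideal U ->
  star_ideal star (jR @^-1` U).
Proof.
move=> Uid; apply/seteqP; split; last exact: sub_star.
have Iid := contraction_ideal jR Uid.
move=> x Ix; apply: (Na_local_mem Uid) => M Mmax.
have [s Ms sx] := star_locally Iid Ix Mmax.
exists s%:P; first by move: sx; rewrite /= polyCM rmorphM.
by move=> /(_ 0); rewrite coefC.
Qed.

(** Locally at [M], [f] is [a * h] where [a] is a coefficient of [f] and [h] has
    a unit coefficient.  Any coefficient of [f] is [a] times some [r], and its
    product with [h] is [f * r]. *)
Lemma coef_dvd_Na f i : scale_set (iota f) setT (jR f`_i).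
Proof.
have Uid := principal_ideal (iota f).
have [fi|fi] := leqP (size f) i.
  by rewrite nth_default // rmorph0; case: Uid.
have f0 : f != 0 by apply: contraTneq fi => ->; rewrite size_poly0.
apply: (Na_local_mem Uid) => M Mmax.
have [a [s [ae Ms sa]]] := locally_principal 0 f Mmax.
have /boolp.choice[r rE] : forall k, exists y, s * f`_k = a * y.
  move=> k; apply: sa.
  have [fk|fk] := leqP (size f) k; first by rewrite nth_default // inE eqxx.
  by rewrite inE mem_nth // orbT.
have a0 : a != 0.
  apply: contraTneq f0 => a0; rewrite negbK -lead_coef_eq0 lead_coefE.
  have /eqP := rE (size f).-1; rewrite a0 mul0r mulf_eq0 => /orP[/eqP s0|//].
  case: Ms; rewrite s0; have [Mst _ _] := Mmax.
  by case: (star_ideal_is_ideal Mst).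
pose h := \poly_(k < size f) r k.
have hE : s%:P * f = a%:P * h.
  apply/polyP => k; rewrite !coefCM coef_poly; case: ltnP => fk //.
  by rewrite nth_default // !mulr0.
exists h.
  exists (jR (r i)) => //.
  have -> : iota h * jR f`_i = iota (h * (f`_i)%:P) by rewrite rmorphM.
  have -> : iota f * jR (r i) = iota (f * (r i)%:P) by rewrite rmorphM.
  congr (iota _); apply: (@mulfI _ a%:P); first by rewrite polyC_eq0.
  rewrite [RHS]mulrA -hE.
  rewrite mulrCA -polyCM -rE polyCM; ring.
have [k fk ak] : exists2 k, (k < size f)%N & a = f`_k.
  move: ae; rewrite inE (negbTE a0) /= => af; exists (index a f).
    by rewrite index_mem.
  by rewrite nth_index.
move=> /(_ k); rewrite coef_poly fk.
suff -> : r k = s by [].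
by apply: (mulfI a0); rewrite -rE ak mulrC.
Qed.

(** A polynomial lies in [U] exactly when its coefficients do. *)
Lemma ext_polyset_contractionK (U : set (Na star)) : is_ideal U ->
  ext iota (polyset (jR @^-1` U)) = U.
Proof.
move=> Uid; rewrite -{2}(ext_contraction iota_localizing Uid).
congr ext; apply/seteqP; split=> f /=; first exact: iota_coefs.
move=> Uf i; have [t _ tE] := coef_dvd_Na f i.
change (U (jR f`_i)); rewrite -tE mulrC.
by case: Uid => _ _; apply.
Qed.

Lemma ext_polyset_imul I J : is_ideal I -> is_ideal J ->
  ext iota (polyset (star (setmul I J))) =
  imul (ext iota (polyset I)) (ext iota (polyset J)).
Proof.
move=> Iid Jid; rewrite -(ext_imul iota_localizing); try exact: polyset_ideal.
have Pid := imul_ideal (polyset I) (polyset J).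
have Uid := ext_ideal iota_localizing Pid.
apply/seteqP; split.
  apply: ext_sub => // f Kf; apply: iota_coefs => // i.
  set U := ext _ _ in Uid *; change ((jR @^-1` U) f`_i).
  rewrite -(contraction_star_ideal Uid); move: (Kf i).
  apply: star_sub; apply: subset_trans (@sub_star _ _ _).
  move=> _ [x Ix [y Jy <-]]; rewrite /= polyCM.
  by apply: ext_mem; apply: mem_imul; apply: polyset_polyC.
have Kid : is_ideal (polyset (star (setmul I J))).
  exact/polyset_ideal/star_is_ideal.
apply: ext_sub; first exact: (ext_ideal iota_localizing Kid).
move=> f Pf; apply: ext_mem; move: f Pf.
apply: imul_sub => // f g If Jg i; apply: star_ge_ideal.
exact: (polyset_imul If Jg).
Qed.

Lemma ext_polyset_radical I : star_ideal star I -> radical I ->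
  radical (ext iota (polyset I)).
Proof.
move=> Ist rI; have Iid := star_ideal_is_ideal Ist.
have Xid := polyset_ideal Iid.
apply: (ext_radical iota_localizing) => //.
apply: radicalI => f n fnI i; apply: (radicalP (n := n) rI).
apply/(ext_polysetP _ Ist); rewrite rmorphXn.
have [t _ <-] := coef_dvd_Na f i; rewrite exprMn mulrC -rmorphXn.
by have [_ _ EM] := ext_ideal iota_localizing Xid; apply: EM; apply: ext_mem.
Qed.

(** Extension and contraction carry a factorization from one ring to the other,
    factor by factor. *)
Lemma star_SP_iff_Na_SP : star_SP_domain star <-> SP_domain (Na star).
Proof.
rewrite star_SP_domainP SP_domainP; split=> [spR U Uid|spT I Ist].
  rewrite -(ext_polyset_contractionK Uid).
  elim: (spR _ (contraction_star_ideal Uid)) => {U Uid} [|J I Jst rJ rpI IH].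
    suff -> : ext iota (polyset (star [set 1])) = ideal_gen [set 1].
      exact: radprod1.
    rewrite ideal_gen1; apply: is_ideal1.
      exact/(ext_ideal iota_localizing)/polyset_ideal/star_is_ideal.
    rewrite -(rmorph1 jR); apply: ext_mem; apply: polyset_polyC.
      exact: star_is_ideal.
    exact: sub_star.
  have Ist : star_ideal star I := radprod_closed (star_closure star) rpI.
  have [Jid Iid] := (star_ideal_is_ideal Jst, star_ideal_is_ideal Ist).
  rewrite ext_polyset_imul //; apply: radprodM => //.
    exact/ideal_gen_id/(ext_ideal iota_localizing)/polyset_ideal.
  exact: ext_polyset_radical.
have Iid := star_ideal_is_ideal Ist.
have Eid := ext_ideal iota_localizing (polyset_ideal Iid).
have -> : I = jR @^-1` (ext iota (polyset I)).
  by apply/seteqP; split=> r /(ext_polysetP r Ist).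
elim: (spT _ Eid) => {I Ist Iid Eid} [|J U Jd rJ rpU IH].
  suff -> : jR @^-1` (ideal_gen [set 1]) = star [set 1] by exact: radprod1.
  rewrite ideal_gen1 preimage_setT; apply/esym/is_ideal1.
    exact: star_is_ideal.
  exact: sub_star.
have Jid : is_ideal J by rewrite -Jd; apply: ideal_gen_ideal.
have Uid := radprod_ideal rpU.
have [Jst Ust] := (contraction_star_ideal Jid, contraction_star_ideal Uid).
have -> : jR @^-1` (ideal_gen (setmul J U)) =
    star (setmul (jR @^-1` J) (jR @^-1` U)).
  rewrite -/(imul J U) -{1}(ext_polyset_contractionK Jid).
  rewrite -{1}(ext_polyset_contractionK Uid) -ext_polyset_imul;
    try exact: contraction_ideal.
  by apply/seteqP; split=> r /(ext_polysetP r (star_idem _ _)).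
apply: radprodM => //.
apply: radicalI => x n; change (J (jR (x ^+ n.+1)) -> J (jR x)).
by rewrite rmorphXn; apply: radicalP.
Qed.

End Nagata.

(** * Localizations at maximal star ideals *)

Lemma fraction_numden (R : idomainType) (z : {fraction R}) :
  exists n d : R, d != 0 /\ z = n%:F / d%:F.
Proof.
elim/quotW: z => x; exists \n_x, \d_x; split; first exact: denom_ratioP.
apply: (mulIf (x := (\d_x)%:F)); first by rewrite tofrac_eq0 denom_ratioP.
rewrite divfK ?tofrac_eq0 ?denom_ratioP //.
change (FracField.mul (\pi_(FracField.type R) x)%qT (\d_x)%:F =
        (\n_x)%:F).
rewrite !piE.
apply/eqmodP; rewrite /= FracField.equivfE /FracField.mulf.
by rewrite !numden_Ratio ?oner_eq0 ?mulr1 ?denom_ratioP // mulrC.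
Qed.

Lemma field_range (R : idomainType) :
  range (fun a : R => a%:F) = [set: {fraction R}] <-> is_field R.
Proof.
split=> [rT x x0|fR].
  have [y _ yE] : range (fun a : R => a%:F) (x%:F)^-1 by rewrite rT.
  apply/unitrPr; exists y; apply/eqP; rewrite -tofrac_eq tofracM tofrac1 yE.
  by rewrite mulfV // tofrac_eq0.
apply/seteqP; split=> // z _.
have [n [d [d0 ->]]] := fraction_numden z.
exists (n * d^-1) => //; rewrite tofracM; congr (_ * _).
apply: (mulfI (x := d%:F)); first by rewrite tofrac_eq0.
by rewrite -tofracM mulfV ?tofrac_eq0 // mulrV ?tofrac1 //; apply: fR.
Qed.

Section AlmostDedekind.
Variables (R : idomainType) (star : star_operation R).
Implicit Types (M : set R) (f g : {poly R}).

(** The union of two principal ideals is an s-ideal; being principal, it is one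
    of them. *)
Lemma DVM_valuation M (HM : star_max star M) :
  DVM (localization (star_max_compl HM)) ->
  forall a b, exists2 s, ~ M s &
    (exists r, s * b = a * r) \/ (exists r, s * a = b * r).
Proof.
move=> [_ prR] a b; pose psi : {rmorphism R -> _} := loc_in (star_max_compl HM).
have divP c d w : psi c * w = psi d ->
    exists2 s, ~ M s & exists r, s * d = c * r.
  move=> cw; have [s [r [Ms sr]]] := loc_inP w.
  exists s => //; exists r; apply: (@loc_in_inj _ (star_max_compl HM)).
  have sr' : psi s * w = psi r := sr.
  by rewrite !rmorphM -/psi -cw -sr' mulrCA.
pose Y : set (localization (star_max_compl HM)) :=
  scale_set (psi a) setT `|` scale_set (psi b) setT.
have [y YE] : principal Y.
  apply: prR; apply/seteqP; split=> [y Yy|y [[x Yx [r _ <-]]|->]].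
  - by left; exists y => //; exists 1; rewrite ?mulr1.
  - by case: Yx => -[w _ <-]; [left|right]; exists (w * r); rewrite ?mulrA.
  - by left; exists 0; rewrite ?mulr0.
have [r _ ra] : scale_set y setT (psi a).
  by rewrite -YE; left; exists 1; rewrite ?mulr1.
have [r' _ rb] : scale_set y setT (psi b).
  by rewrite -YE; right; exists 1; rewrite ?mulr1.
have : Y y by rewrite YE; exists 1; rewrite ?mulr1.
case=> -[w _ wy].
  have [|s Ms sr] := @divP a b (w * r'); first by rewrite mulrA wy.
  by exists s => //; left.
have [|s Ms sr] := @divP b a (w * r); first by rewrite mulrA wy.
by exists s => //; right.
Qed.

Lemma almost_Dedekind_valuation : star_almost_Dedekind star ->
  locally_valuation star.
Proof.
move=> [/field_range fR|dvm] M Mmax a b; last first.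
  exact: (DVM_valuation (dvm M Mmax)).
exists 1; first exact: star_max_not1 Mmax.
have [->|a0] := eqVneq a 0; first by right; exists 0; rewrite !mulr0.
by left; exists (a^-1 * b); rewrite mul1r mulVKr //; apply: fR.
Qed.

Section AtMaximal.
Variables (M : set R) (HM : star_max star M).

Lemma polyset_compl1 : ~ polyset M 1.
Proof. by apply: N_star_notin_polyset HM _; apply: N_star1. Qed.

Lemma polyset_compl_neq0 f : ~ polyset M f -> f != 0.
Proof.
move=> Mf; apply/eqP => f0; apply: Mf => i; rewrite f0 coef0.
by have [Mst _ _] := HM; case: (star_ideal_is_ideal Mst).
Qed.

(** The complement of the prime ideal M[X]; its ring of fractions R_M(X) is the
    localization of the Nagata ring at the extension of [M]. *)
Definition polyset_compl : mulset {poly R} :=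
  @MulSet {poly R} (fun f => ~ polyset M f) polyset_compl1
    (fun f g => @notin_polysetM R star M f g HM) polyset_compl_neq0.

Let L := localization polyset_compl.
Let phi : {rmorphism {poly R} -> L} := loc_in polyset_compl.

Lemma Na_SP_local_SP : SP_domain (Na star) -> SP_domain L.
Proof.
have NS f : Nagata_mulset star f -> polyset_compl f.
  exact: N_star_notin_polyset.
exact: (SP_localizing (loc_incl_localizing NS)).
Qed.

Let Mid : is_ideal M.
Proof. by have [Mst _ _] := HM; apply: star_ideal_is_ideal Mst. Qed.

Lemma local_at_polyset : is_ideal (@nonunits L).
Proof.
have Xid := polyset_ideal Mid.
have Eid := ext_ideal (loc_in_localizing polyset_compl) Xid.
suff -> : @nonunits L = ext phi (polyset M) by [].
have [_ _ XM] := Xid.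
apply/seteqP; split=> y.
  have [s [f [Ms sf]]] := loc_inP y => My.
  exists s, f; split=> //; first exact: (loc_in_unit Ms).
  apply: contrapT => Mf; move: My; rewrite /nonunits /=.
  suff -> : y \is a GRing.unit by [].
  by move: (@loc_in_unit _ polyset_compl f Mf); rewrite -sf unitrM => /andP[].
move=> [s [f [su Mf sf]]]; apply/negP => yu.
have fu : phi f \is a GRing.unit by rewrite -sf unitrM su yu.
have [t [g [Mt tg]]] := loc_inP (phi f)^-1.
apply: Mt; suff -> : t = g * f by apply: XM.
apply: (@loc_in_inj _ polyset_compl).
have tg' : phi t / phi f = phi g := tg.
by rewrite rmorphM -/phi -tg' divrK.
Qed.

(** Divisibility of constants descends from R_M(X) to R_M: compare
    coefficients at an exponent where the denominator is outside [M]. *)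
Lemma local_dvd a b w : phi a%:P * w = phi b%:P ->
  exists2 s, ~ M s & exists r, s * b = a * r.
Proof.
move=> aw; have [p [f [/notin_polyset[i Mpi] pf]]] := loc_inP w.
exists p`_i => //; exists f`_i; rewrite -coefMC -coefCM.
suff -> : p * b%:P = a%:P * f by [].
apply: (@loc_in_inj _ polyset_compl).
have pf' : phi p * w = phi f := pf.
by rewrite !rmorphM -/phi -aw -pf' mulrCA.
Qed.

Hypothesis nfR : ~ is_field R.

(** If [M] were zero, every proper principal ideal, being a star ideal above
    [M], would be zero. *)
Lemma star_max_nonzero : exists2 m, M m & m != 0.
Proof.
have [a a0 au] : exists2 a : R, a != 0 & a \isn't a GRing.unit.
  apply: contrapT => nex; apply: nfR => x x0; apply/negPn/negP => xu.
  by apply: nex; exists x.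
apply: contrapT => nex.
have M0 : M `<=` [set 0].
  by move=> m Mm; apply/eqP/negPn/negP => m0; apply: nex; exists m.
have [_ _ maxM] := HM; have starT : star setT = setT.
  by apply/seteqP; split=> // y _; apply: sub_star.
have aM : scale_set a setT = M.
  apply: maxM.
  - by rewrite /star_ideal -star_scale starT.
  - move=> aT; have [r _ ar] : scale_set a setT 1 by rewrite aT.
    by move/negP: au; apply; apply/unitrPr; exists r.
  - by move=> m /M0->; exists 0; rewrite ?mulr0.
have /M0 /= /eqP : M a by rewrite -aM; exists 1; rewrite ?mulr1.
by rewrite (negbTE a0).
Qed.

Hypothesis spT : SP_domain (Na star).

(** The order function of the discrete valuation domain R_M(X), restricted to
    [R]; values at 0 are arbitrary. *)
Lemma SP_valuation : exists v : R -> nat, forall a b, a != 0 -> b != 0 ->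
  (v a <= v b)%N -> exists2 s, ~ M s & exists r, s * b = a * r.
Proof.
have nfL : ~ is_field L.
  have [m Mm m0] := star_max_nonzero.
  move=> /(_ (phi m%:P)); rewrite -(rmorph0 phi) (inj_eq (@loc_in_inj _ _)).
  rewrite polyC_eq0 => /(_ m0) mu.
  have [s Ms [r]] : exists2 s, ~ M s & exists r, s * 1 = m * r.
    by apply: (local_dvd (w := (phi m%:P)^-1)); rewrite mulrV // rmorph1.
  by rewrite mulr1 mulrC => sE; apply: Ms; rewrite sE; case: Mid => _ _; apply.
have spL := Na_SP_local_SP spT.
have [z [Mz zE]] := SP_local_uniformizer local_at_polyset spL nfL.
have /boolp.choice[v vE] : forall a : R, exists n, a != 0 ->
    exists u, u \is a GRing.unit /\ phi a%:P = u * z ^+ n.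
  move=> a; have [->|a0] := eqVneq a 0; first by exists 0%N.
  have [|n [u uE]] := zE (phi a%:P); last by exists n => _; exists u.
  by rewrite -(rmorph0 phi) (inj_eq (@loc_in_inj _ _)) polyC_eq0.
exists v => a b /vE[u [uu uE]] /vE[u' [uu' uE']] vab.
apply: (local_dvd (w := u^-1 * u' * z ^+ (v b - v a))).
rewrite uE uE' -{2}(subnK vab) exprD.
rewrite -[in RHS](mulKr uu u'); ring.
Qed.

(** A nonzero s-ideal is generated by any of its nonzero elements of least
    order. *)
Lemma SP_DVM : DVM (localization (star_max_compl HM)).
Proof.
set S := star_max_compl HM.
pose psi : {rmorphism R -> localization S} := loc_in S.
have psiU s : ~ M s -> psi s \is a GRing.unit by move=> Ms; apply: loc_in_unit.
have psi0 a : (psi a == 0) = (a == 0).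
  by rewrite -(rmorph0 psi) (inj_eq (@loc_in_inj _ _)).
split=> [fE|Y YE].
  have [m Mm m0] := star_max_nonzero.
  have /fE mu : psi m != 0 by rewrite psi0.
  have [s [r [Ms sr]]] := loc_inP (psi m)^-1.
  apply: Ms; suff -> : s = r * m by case: Mid => _ _; apply.
  apply: (@loc_in_inj _ S).
  have sr' : psi s / psi m = psi r := sr.
  by rewrite rmorphM -/psi -sr' divrK.
have Y0 : Y 0 by rewrite YE; right.
have YM y r : Y y -> Y (r * y).
  by move=> Yy; rewrite YE; left; exists y => //; exists r; rewrite // mulrC.
have numer y : exists s a, [/\ ~ M s, psi s * y = psi a & Y y -> Y (psi a)].
  have [s [a [Ms sa]]] := loc_inP y; exists s, a; split=> // Yy.
  have <- : psi s * y = psi a := sa.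
  exact: YM.
have [[y Yy y0]|Yz] := pselect (exists2 y, Y y & y != 0); last first.
  exists 0; apply/seteqP; split=> [y Yy|_ [r _ <-]]; last by rewrite mul0r.
  exists 0; rewrite // mulr0; apply/esym/eqP/negPn/negP => y0.
  by apply: Yz; exists y.
have [v vP] := SP_valuation.
pose P n := exists a, [/\ a != 0, Y (psi a) & v a = n].
have exP : exists n, `[< P n >].
  have [s [a [Ms sa /(_ Yy) Ya]]] := numer y.
  exists (v a); apply/asboolP; exists a; split=> //.
  by rewrite -psi0 -sa mulf_neq0 // psi0; apply: (star_max_notN0 HM).
case: (ex_minnP exP) => n /asboolP[a [a0 Ya van]] nmin.
exists (psi a); apply/seteqP; split=> [x Yx|_ [r _ <-]]; last first.
  by rewrite mulrC; apply: YM.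
have [s [b [Ms sb /(_ Yx) Yb]]] := numer x.
have su := psiU s Ms.
have [b0|b0] := eqVneq b 0.
  by exists 0; rewrite // mulr0 -[x](mulKr su) sb b0 rmorph0 mulr0.
have [|s' Ms' [r sr]] := vP a b a0 b0.
  by rewrite van; apply: nmin; apply/asboolP; exists b.
have su' := psiU s' Ms'.
exists (psi r / (psi s' * psi s)) => //.
have ssu : psi s' * psi s \is a GRing.unit by rewrite unitrM su'.
apply: (mulIr ssu); rewrite -[LHS]mulrA divrK // -[LHS]rmorphM -sr rmorphM -sb.
ring.
Qed.

End AtMaximal.

End AlmostDedekind.

Theorem proposition6p6 (R : idomainType) (star : star_operation R) :
  (star_almost_Dedekind star /\ star_SP_domain star) <-> SP_domain (Na star).
Proof.
split=> [[aD spR]|spT].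
  exact/(star_SP_iff_Na_SP (almost_Dedekind_valuation aD)).
have aD : star_almost_Dedekind star.
  have [fR|nfR] := pselect (is_field R); first by left; apply/field_range.
  by right=> M HM; apply: SP_DVM.
by split=> //; apply/(star_SP_iff_Na_SP (almost_Dedekind_valuation aD)).
Qed.
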